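(* Let $X$ be a Banach space whose dual $X^*$ is separable. Then there exists a separable Banach space $Z_X$ which is isomorphic to a dual Banach space, is asymptotic-$c_0$, and satisfies $Z_X^{**}=Z_X\oplus X^*$, i.e. the canonical image of $Z_X$ in $Z_X^{**}$ is complemented and has a complement isomorphic to $X^*$.
   Context: A Banach space $X$ is $C$-asymptotically $c_0$ ($C\ge1$) if for every $k\in\mathbb N$: there is a closed finite-codimensional subspace $X_1$ such that for all $x_1\in S_{X_1}$ there is a closed finite-codimensional $X_2$ such that for all $x_2\in S_{X_2}$ ... there is a closed finite-codimensional $X_k$ such that for all $x_k\in S_{X_k}$, $\|\sum_{i=1}^ka_ix_i\|\le C\max_i|a_i|$ for all $(a_i)\in\mathbb R^k$. $X$ is asymptotic-$c_0$ if it is $C$-asymptotically $c_0$ for some $C\ge1$. *)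

(* Defs.v *)
From HB Require Import structures.
From mathcomp Require Import all_boot all_order all_algebra.
From mathcomp Require Import all_classical all_reals all_analysis.
Set Implicit Arguments. Unset Strict Implicit. Unset Printing Implicit Defensive.
Import Order.TTheory GRing.Theory Num.Theory.
Import numFieldNormedType.Exports.
Local Open Scope classical_set_scope.
Local Open Scope ring_scope.

Section Defs.
Variable R : realType.

Definition is_linear (V W : lmodType R) (f : V -> W) : Prop :=
  forall (a : R) (x y : V), f (a *: x + y) = a *: f x + f y.

Definition dual_el (X : normedModType R) (f : X -> R) : Prop :=
  is_linear (f : X -> R^o) /\ continuous f.

Definition dnorm (X : normedModType R) (f : X -> R) : R :=
  sup [set `|f x| | x in [set x : X | `|x| <= 1]].

(* elements of X^**: linear functionals on X^* bounded for the dual norm;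
   they are represented as functions on (X -> R) whose values matter only
   on dual_el *)
Definition bidual_el (X : normedModType R) (F : (X -> R) -> R) : Prop :=
  (forall (a : R) (f g : X -> R), dual_el f -> dual_el g ->
      F (fun x => a * f x + g x) = a * F f + F g) /\
  (exists M : R, forall f, dual_el f -> `|F f| <= M * dnorm f).

Definition ddnorm (X : normedModType R) (F : (X -> R) -> R) : R :=
  sup [set `|F f| | f in [set f : X -> R | dual_el f /\ dnorm f <= 1]].

Definition canJ (X : normedModType R) (x : X) : (X -> R) -> R := fun f => f x.

Definition separable (X : normedModType R) : Prop :=
  exists D : set X, countable D /\ closure D = setT.

Definition dual_separable (X : normedModType R) : Prop :=
  exists D : set (X -> R), countable D /\ (forall g, D g -> dual_el g) /\
    forall f, dual_el f -> forall eps : R, 0 < eps ->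
      exists2 g, D g & dnorm (fun x => f x - g x) < eps.

Definition isomorphic_to_dual (Z : normedModType R) : Prop :=
  exists (W : completeNormedModType R) (T : Z -> (W -> R)),
    (forall z, dual_el (T z)) /\
    is_linear (T : Z -> (W -> R^o)) /\
    (forall f, dual_el f -> exists z, T z = f) /\
    exists c C : R, 0 < c /\
      forall z, c * `|z| <= dnorm (T z) /\ dnorm (T z) <= C * `|z|.

Definition subspace (Z : normedModType R) (Y : set Z) : Prop :=
  Y 0 /\ forall (a : R) x y, Y x -> Y y -> Y (a *: x + y).

Definition closed_fincodim (Z : normedModType R) (Y : set Z) : Prop :=
  subspace Y /\ closed Y /\
  exists s : seq Z, forall z : Z, exists2 y, Y y &
     exists c : 'I_(size s) -> R, z = y + \sum_(i < size s) c i *: s`_i.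

Fixpoint asym_c0_game (Z : normedModType R) (C : R) (n : nat) (xs : seq Z)
  : Prop :=
  match n with
  | 0 => forall a : seq R, size a = size xs ->
      `|\sum_(i < size xs) a`_i *: xs`_i|
        <= C * \big[Num.max/0]_(i < size xs) `|a`_i|
  | n'.+1 => exists Y : set Z, closed_fincodim Y /\
      forall x : Z, Y x -> `|x| = 1 -> asym_c0_game C n' (rcons xs x)
  end.

Definition C_asymptotically_c0 (Z : normedModType R) (C : R) : Prop :=
  1 <= C /\ forall k : nat, @asym_c0_game Z C k [::].

Definition asymptotic_c0 (Z : normedModType R) : Prop :=
  exists C : R, C_asymptotically_c0 Z C.

(* there is a map S : X^* -> Z^** such that (z, phi) |-> J z + S phi is a
   linear isomorphism of Z (+) X^* onto Z^**; i.e. J(Z) is complemented in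
   Z^** with a complement (S(X^* )) isomorphic to X^*. *)
Definition bidual_decomp (Z X : normedModType R) : Prop :=
  exists S : (X -> R) -> ((Z -> R) -> R),
    (forall phi, dual_el phi -> bidual_el (S phi)) /\
    (forall (a : R) phi psi, dual_el phi -> dual_el psi ->
       forall f, dual_el f ->
         S (fun x => a * phi x + psi x) f = a * S phi f + S psi f) /\
    (forall F, bidual_el F -> exists z : Z, exists2 phi, dual_el phi &
       forall f, dual_el f -> F f = canJ z f + S phi f) /\
    exists c C : R, 0 < c /\
      forall (z : Z) phi, dual_el phi ->
        c * (`|z| + dnorm phi) <= ddnorm (fun f => canJ z f + S phi f) /\
        ddnorm (fun f => canJ z f + S phi f) <= C * (`|z| + dnorm phi).

End Defs.

(* Main.v *)
Require Import Defs.
From HB Require Import structures.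
From mathcomp Require Import all_boot all_order all_algebra.
From mathcomp Require Import all_classical all_reals all_analysis.
From mathcomp Require Import ring lra.
Set Implicit Arguments. Unset Strict Implicit. Unset Printing Implicit Defensive.
Import Order.TTheory GRing.Theory Num.Theory.
Import numFieldNormedType.Exports.
Local Open Scope classical_set_scope.
Local Open Scope ring_scope.

(* Lindenstrauss' construction over a Tsirelson-type basis. Let (x_i) be a
   sequence in the unit ball of X in which every direction is approximated
   infinitely often. Norm finitely supported sequences by a set K of functionals
   for which the basis is boundedly complete and asymptotically l_1, and for
   which Q a = sum_i a_i x_i is a contraction onto X. The space W1 of sequences
   of finite K-norm is the dual of the space Z of those G in W1^* whose tails
   tend to 0; being predual to an asymptotic-l_1 basis, Z is asymptotic-c_0.

   The heart of the matter is W1^* = Z + Q^*(X^* ), which gives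
   Z^** = W1^* = Z (+) X^*, and also Z = (ker Q)^* by restriction. It reduces to:
   a functional G on W1 is small on far-out vectors of the unit ball with small
   image under Q. If d bounds G on such vectors, take successive ones v_0, ...,
   v_m on which G exceeds 9d/10; the vector v_0 + (v_1 + ... + v_m)/m has norm at
   most 8/5, because K_step charges only one half of the average when it sees
   v_0, yet G is at least 9d/5 there, so that d can be lowered to 9d/10. *)

(** All spaces are handled as spaces of scalar sequences: [bd K] describes W1 and [bd (polar K)] its
    dual. This is legitimate because bounded completeness makes the tails of every element of W1
    tend to 0 in norm, so a functional on W1 is determined by its values on the basis. The obstacle
    is [K_block]: its functionals make Q a contraction but escape the factor 1/2 of [K_step], so the
    averaging argument can only control vectors with small image under Q. Once G is small on these,
    G hardly distinguishes far-out vectors with the same image. Hence [phi y], the limit of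
    [|y| * G i] along indices with [|y| *: x i] tending to y, is a well-defined functional, and G
    minus its pullback by Q has vanishing tails. That every direction recurs infinitely often is
    used three times: to read off [phi] arbitrarily far out, to lift vectors of X to W1 with support
    arbitrarily far out, and to recover the norm of [phi] from coordinates at which the Z-part is
    negligible. *)

Section Masks.

(** * Truncations and finite pairings of scalar sequences *)

Definition res (R : nmodType) s t (a : nat -> R) : nat -> R :=
  fun i => if (s <= i < t)%N then a i else 0.

Definition tail (R : nmodType) s (a : nat -> R) : nat -> R :=
  fun i => if (s <= i)%N then a i else 0.

Lemma sum_mask (V : nmodType) (F : nat -> V) s t s' t' :
  \sum_(s' <= i < t') (if (s <= i < t)%N then F i else 0) =
  \sum_(maxn s s' <= i < minn t t') F i.
Proof.
rewrite -big_mkcond /= [RHS](big_nat_widen _ _ t') ?geq_minr//.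
rewrite [RHS](big_nat_widenl _ s') ?leq_maxr//=.
rewrite [LHS]big_nat_cond [RHS]big_nat_cond; apply: eq_bigl => i.
rewrite !geq_max !leq_min.
by case: (leqP s' i) => //= _; case: (ltnP i t') => //=; rewrite ?andbT ?andbF // andbC.
Qed.

Lemma sum_mask_sub (V : nmodType) (F : nat -> V) s t s' t' :
  (s' <= s)%N -> (t <= t')%N ->
  \sum_(s' <= i < t') (if (s <= i < t)%N then F i else 0) =
  \sum_(s <= i < t) F i.
Proof. by move=> ss tt; rewrite sum_mask (maxn_idPl ss) (minn_idPl tt). Qed.

End Masks.

Definition pair_ (R : pzRingType) (g a : nat -> R) s t : R :=
  \sum_(s <= i < t) g i * a i.

Definition unit_seq (R : pzRingType) k : nat -> R := fun i => if i == k then 1 else 0.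

Section Pairing.
Variable R : comPzRingType.
Implicit Types g a : nat -> R.

Lemma pairC g a s t : pair_ g a s t = pair_ a g s t.
Proof. by apply: eq_bigr => i _; rewrite mulrC. Qed.

Lemma pair_lin c g g' a s t :
  pair_ (fun i => c * g i + g' i) a s t = c * pair_ g a s t + pair_ g' a s t.
Proof.
rewrite /pair_ mulr_sumr -big_split; apply: eq_bigr => i _ /=.
by rewrite mulrDl mulrA.
Qed.

Lemma pair_linr c g a a' s t :
  pair_ g (fun i => c * a i + a' i) s t = c * pair_ g a s t + pair_ g a' s t.
Proof. by rewrite pairC pair_lin !(pairC g). Qed.

Lemma pairZr c g a s t : pair_ g (fun i => c * a i) s t = c * pair_ g a s t.
Proof. by rewrite /pair_ mulr_sumr; apply: eq_bigr => i _; rewrite mulrCA. Qed.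

Lemma pairZl c g a s t : pair_ (fun i => c * g i) a s t = c * pair_ g a s t.
Proof. by rewrite pairC pairZr pairC. Qed.

Lemma pairN g a s t : pair_ (fun i => - g i) a s t = - pair_ g a s t.
Proof. by rewrite /pair_ -sumrN; apply: eq_bigr => i _; rewrite mulNr. Qed.

Lemma pairDr g a a' s t : pair_ g (fun i => a i + a' i) s t = pair_ g a s t + pair_ g a' s t.
Proof. by rewrite /pair_ -big_split; apply: eq_bigr => i _ /=; rewrite mulrDr. Qed.

Lemma pairBr g a a' s t : pair_ g (fun i => a i - a' i) s t = pair_ g a s t - pair_ g a' s t.
Proof. by rewrite pairDr; congr (_ + _); rewrite pairC pairN pairC. Qed.

Lemma pair_res g a s t s' t' :
  pair_ g (res s t a) s' t' = pair_ g a (maxn s s') (minn t t').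
Proof.
rewrite /pair_ -sum_mask; apply: eq_bigr => i _; rewrite /res.
by case: ifP => // _; rewrite mulr0.
Qed.

Lemma pair_res_sub g a s t s' t' : (s' <= s)%N -> (t <= t')%N ->
  pair_ g (res s t a) s' t' = pair_ g a s t.
Proof. by move=> ss tt; rewrite pair_res (maxn_idPl ss) (minn_idPl tt). Qed.

Lemma pair_resC g a s t s' t' :
  pair_ g (res s t a) s' t' = pair_ (res s t g) a s' t'.
Proof. by rewrite [RHS]pairC !pair_res pairC. Qed.

Lemma pair_tail g a s t : pair_ g (tail s a) 0 t = pair_ g a s t.
Proof.
rewrite -[s in RHS]maxn0 -[t in RHS](minnn t) -pair_res; apply: eq_big_nat => i.
by move=> /andP[_ it]; rewrite /tail /res it andbT.
Qed.

Lemma pair_cat g a s t r : (s <= t)%N -> (t <= r)%N ->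
  pair_ g a s r = pair_ g a s t + pair_ g a t r.
Proof. by move=> st tr; rewrite /pair_ (big_cat_nat st tr). Qed.

Lemma pair_unit k a n : (k < n)%N -> pair_ (unit_seq R k) a 0 n = a k.
Proof.
move=> kn; rewrite /pair_ big_mkord (bigD1 (Ordinal kn)) //= big1 => [|i].
  by rewrite /unit_seq eqxx mul1r addr0.
by rewrite /unit_seq -val_eqE /= => /negPf ->; rewrite mul0r.
Qed.

Lemma pair_unit_sub k a s n : (s <= k < n)%N -> pair_ (unit_seq R k) a s n = a k.
Proof.
move=> /andP[sk kn]; rewrite -(pair_unit a kn) (@pair_cat _ _ 0%N s n) //; last exact: leq_trans sk (ltnW kn).
rewrite [X in X + _]/pair_ big_nat_cond big1 ?add0r// => i /andP[/andP[_ is_] _].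
by rewrite /unit_seq ifF ?mul0r//; apply/negbTE; rewrite neq_ltn (leq_trans is_ sk).
Qed.

End Pairing.

(** * Norms on sequences defined by a set of functionals, and the Banach spaces they give *)

Section Bound.
Variable R : realType.
Implicit Types (A : set (nat -> R)) (a b g : nat -> R).

(* The partial sums let the basis be monotone for any norming set [A]. *)
Definition bd A (M : R) a : Prop := forall g n, A g -> `|pair_ g a 0 n| <= M.

Lemma bd_le A M M' a : M <= M' -> bd A M a -> bd A M' a.
Proof. by move=> MM' h g n Ag; apply: le_trans (h g n Ag) MM'. Qed.

Lemma bd0 A M : 0 <= M -> bd A M (fun=> 0).
Proof.
move=> M0 g n _; rewrite /pair_ big1 ?normr0 // => i _; exact: mulr0.
Qed.

Lemma bd_lin A M M' c a b : bd A M a -> bd A M' b ->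
  bd A (`|c| * M + M') (fun i => c * a i + b i).
Proof.
move=> ha hb g n Ag; rewrite pair_linr (le_trans (ler_normD _ _))// lerD ?hb//.
by rewrite normrM ler_wpM2l ?ha.
Qed.

Lemma bdZ A M c a : bd A M a -> bd A (`|c| * M) (fun i => c * a i).
Proof. by move=> h g n Ag; rewrite pairZr normrM ler_wpM2l ?h. Qed.

Lemma bdN A M a : bd A M a -> bd A M (fun i => - a i).
Proof. by move=> h g n Ag; rewrite pairC pairN normrN pairC h. Qed.

Lemma bdD A M M' a b : bd A M a -> bd A M' b -> bd A (M + M') (fun i => a i + b i).
Proof.
by move=> ha hb g n Ag; rewrite pairDr (le_trans (ler_normD _ _))// lerD ?hb ?ha.
Qed.

Lemma bdB A M M' a b : bd A M a -> bd A M' b -> bd A (M + M') (fun i => a i - b i).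
Proof. by move=> ha hb; apply: bdD => //; apply: bdN. Qed.

(** The supremum is meaningful only for a bounded set of values, so estimates are mostly phrased
    with [bd] and an explicit constant. *)
Definition nrm A a : R := sup [set `|pair_ g a 0 n| | g in A & n in setT].

Section WithUnits.
Variable A : set (nat -> R).
Hypothesis Aunit : forall k, A (unit_seq R k).

Lemma bd_coord M a k : bd A M a -> `|a k| <= M.
Proof. by move=> /(_ _ k.+1 (Aunit k)); rewrite pair_unit. Qed.

Lemma bd_ge0 M a : bd A M a -> 0 <= M.
Proof. by move=> /(bd_coord 0) h; apply: le_trans h. Qed.

Let nset a := [set `|pair_ g a 0 n| | g in A & n in setT].

Let nset0 a : nset a !=set0.
Proof.
exists `|pair_ (unit_seq R 0) a 0 0|.
by exists (unit_seq R 0); [exact: Aunit|exists 0%N].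
Qed.

Lemma nrm_le M a : bd A M a -> nrm A a <= M.
Proof.
move=> h; apply: ge_sup; first exact: nset0.
move=> _ [g Ag [n _ <-]]; exact: h.
Qed.

Lemma bd_nrm M a : bd A M a -> bd A (nrm A a) a.
Proof.
move=> h g n Ag; apply: (@ub_le_sup _ (nset a)); last by exists g => //; exists n.
by exists M => _ [g' Ag' [n' _ <-]]; apply: h.
Qed.

End WithUnits.

(** The unit ball of the space normed by [A]. The pairing being symmetric, it serves in turn as the
    norming set of the dual. *)
Definition polar A : set (nat -> R) := bd A 1.

End Bound.

(** One interface for both Banach spaces of the proof: the predual, normed by [polar K], and the
    kernel of Q, normed by [K]. The unit vectors among the functionals make coordinates continuous,
    and [member_closed] yields completeness. *)
Record seqspace (R : realType) := SeqSpace {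
  norming : set (nat -> R);
  member : set (nat -> R);
  norming_unit : forall k, norming (unit_seq R k);
  member0 : member (fun=> 0);
  member_lin : forall (c : R) a b, member a -> member b ->
    member (fun i => c * a i + b i);
  member_closed : forall M a, bd norming M a ->
    (forall e : R, 0 < e -> exists2 b, member b & bd norming e (fun i => a i - b i)) ->
    member a }.

Section SeqSpaceType.
Variables (R : realType) (S : seqspace R).

Definition carrier : {pred nat -> R} :=
  [pred a : nat -> R | `[< member S a /\ exists M, bd (norming S) M a >]].

Record seqT := SeqT { seq_val :> nat -> R; _ : seq_val \in carrier }.

HB.instance Definition _ := [isSub for seq_val].
HB.instance Definition _ := [Choice of seqT by <:].

Lemma carrier_submod_closed : submod_closed carrier.
Proof.
split; first by apply/asboolP; split; [exact: member0|exists 0; exact: bd0].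
move=> c a b /asboolP[ma [M aM]] /asboolP[mb [M' bM]]; apply/asboolP; split.
  exact: member_lin.
by eexists; apply: bd_lin; [exact: aM|exact: bM].
Qed.

HB.instance Definition _ := GRing.isSubmodClosed.Build _ _ carrier
  carrier_submod_closed.
HB.instance Definition _ := [SubChoice_isSubLmodule of seqT by <:].

Lemma seq_val_member (x : seqT) : member S x.
Proof. by case: x => a /= /asboolP[]. Qed.

Lemma seq_val_bd_nrm (x : seqT) : bd (norming S) (nrm (norming S) x) x.
Proof. by case: x => a /= /asboolP[_ [M]]; apply: bd_nrm; exact: norming_unit. Qed.

Lemma seqT_exists M a : member S a -> bd (norming S) M a -> exists x : seqT, x = a :> (nat -> R).
Proof.
move=> ma aM; have ac : a \in carrier by apply/asboolP; split => //; exists M.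
by exists (SeqT ac).
Qed.

Let nm (x : seqT) := nrm (norming S) x.

Let nmP M x : bd (norming S) M (seq_val x) -> nm x <= M.
Proof. by apply: nrm_le; exact: norming_unit. Qed.

Let nmD x y : nm (x + y) <= nm x + nm y.
Proof. by apply: nmP; apply: bdD; exact: seq_val_bd_nrm. Qed.

Let nm_leZ (c : R) x : nm (c *: x) <= `|c| * nm x.
Proof. by apply: nmP; apply: bdZ; exact: seq_val_bd_nrm. Qed.

Let nmZ (c : R) x : nm (c *: x) = `|c| * nm x.
Proof.
apply/eqP; rewrite eq_le nm_leZ /=; have [->|c0] := eqVneq c 0.
  by rewrite normr0 mul0r scale0r (bd_ge0 (@norming_unit _ S) (seq_val_bd_nrm 0)).
rewrite -ler_pdivlMl ?normr_gt0// -normfV.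
by apply: le_trans (nm_leZ _ _); rewrite scalerA mulVf// scale1r.
Qed.

Let nm0 x : nm x = 0 -> x = 0.
Proof.
move=> x0; apply/val_inj/funext => k /=.
have := bd_coord (@norming_unit _ S) k (seq_val_bd_nrm x).
by rewrite -/(nm x) x0 normr_le0 => /eqP.
Qed.

HB.instance Definition _ := Lmodule_isNormed.Build R seqT nmD nmZ nm0.

Lemma bd_norm (x : seqT) : bd (norming S) `|x| x.
Proof. exact: seq_val_bd_nrm. Qed.

Lemma norm_le_bd (x : seqT) M : bd (norming S) M x -> `|x| <= M.
Proof. exact: nmP. Qed.

Lemma coord_le_norm (x : seqT) k : `|x k| <= `|x|.
Proof. exact: (bd_coord (@norming_unit _ S) k (bd_norm x)). Qed.

Lemma seqTD (x y : seqT) k : (x + y) k = x k + y k. Proof. by []. Qed.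
Lemma seqTB (x y : seqT) k : (x - y) k = x k - y k. Proof. by []. Qed.
Lemma seqTZ (c : R) (x : seqT) k : (c *: x) k = c * x k. Proof. by []. Qed.

Lemma seqT_sum (I : Type) (r : seq I) (f : I -> seqT) k :
  (\sum_(i <- r) f i) k = \sum_(i <- r) f i k.
Proof. by elim/big_rec2: _ => // i y1 y2 _ <-. Qed.

(** Coordinates are Cauchy, hence converge. A partial pairing involves finitely many coordinates, so
    the norm estimates of the Cauchy filter pass to the coordinatewise limit. *)
Lemma seqT_complete (F : set_system seqT) : ProperFilter F -> cauchy F -> cvg F.
Proof.
move=> FF /cauchyP Fc.
have cv k : cvg ((fun x : seqT => x k) @ F).
  apply: R_complete; apply: cauchy_exP => e e0.
  have [x Fx] := Fc _ e0; exists (x k).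
  apply: (@filterS _ F _ (ball x e) ((fun z : seqT => z k) @^-1` ball (x k) e) _ Fx).
  move=> y; rewrite -!ball_normE /= => xy.
  by apply: le_lt_trans xy; exact: (coord_le_norm (x - y)).
pose a k := lim ((fun x : seqT => x k) @ F).
have Fa e : 0 < e -> exists2 x : seqT, F (ball x e) &
    bd (norming S) e (fun i => x i - a i).
  move=> e0; have [x Fx] := Fc _ e0; exists x => // g n gS.
  have h : (fun z : seqT => `|pair_ g (fun i => x i - z i) 0 n|) @ F -->
           `|pair_ g (fun i => x i - a i) 0 n|.
    apply: cvg_norm; rewrite /pair_; apply: cvg_big => [|i _].
      by move=> z; apply: add_continuous.
    by apply: cvgM; [exact: cvg_cst|apply: cvgB; [exact: cvg_cst|exact: cv]].
  rewrite -(cvg_lim (@Rhausdorff R) h); apply: limr_le.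
    by apply/cvg_ex; eexists; exact: h.
  apply: filterS Fx => z; rewrite -ball_normE /= => xz.
  by apply: le_trans (ltW xz); apply: (bd_norm (x - z)).
have [M aM] : exists M, bd (norming S) M a.
  have [x _ xa] := Fa 1 ltr01; eexists.
  rewrite (_ : a = fun i => x i - (x i - a i)); last by apply/funext => i; ring.
  exact: (bdB (bd_norm x) xa).
have ma : member S a.
  apply: (member_closed aM) => e e0; have [x _ xa] := Fa e e0.
  exists x; first exact: seq_val_member.
  rewrite (_ : (fun _ => _) = fun i => - (x i - a i)); last by apply/funext => i; ring.
  exact: bdN.
have [y ya] := seqT_exists ma aM.
apply/cvg_ex; exists y; apply/cvgrPdist_lt => e e0.
have [x Fx xa] := Fa _ (divr_gt0 e0 (ltr0n _ 2)).
near=> z; rewrite -[y](subrK x) -addrA (le_lt_trans (ler_normD _ _))// [e]splitr.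
rewrite ler_ltD//; last first.
  by near: z; apply: filterS Fx => z; rewrite -ball_normE.
rewrite distrC; apply: norm_le_bd.
by rewrite (_ : seq_val _ = fun i => x i - a i) //; apply/funext => i; rewrite seqTB ya.
Unshelve. all: by end_near. Qed.

HB.instance Definition _ := Uniform_isComplete.Build seqT seqT_complete.

End SeqSpaceType.

Definition seqspace_banach (R : realType) (S : seqspace R) : completeNormedModType R := seqT S.

(** * The Hahn-Banach theorem for a sublinear function on a linear subset *)

Section HahnBanach.
Variables (R : realType) (V : lmodType R) (D : set V) (p : V -> R).
Hypothesis D_lin : forall (c : R) x y, D x -> D y -> D (c *: x + y).
Hypothesis p_add : forall x y, D x -> D y -> p (x + y) <= p x + p y.
Hypothesis p_scale : forall (c : R) x, 0 < c -> D x -> p (c *: x) = c * p x.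

(** A partial functional dominated by [p] is represented by its graph. Single-valuedness follows: a
    value r over 0 comes with -r, and both are at most [p 0], which is 0. *)
Let good (H : set (V * R)) :=
  (forall (c : R) x y r s, H (x, r) -> H (y, s) -> H (c *: x + y, c * r + s)) /\
  (forall x r, H (x, r) -> D x /\ r <= p x).

Let D_zero x : D x -> D 0.
Proof. by move=> Dx; have := D_lin (-1) Dx Dx; rewrite scaleN1r addNr. Qed.

Let p_zero x : D x -> p 0 = 0.
Proof.
move=> /D_zero D0; have := p_scale (ltr0n _ 2) D0; rewrite scaler0 => h; lra.
Qed.

Let good0 H x r : good H -> H (x, r) -> H (0, 0).
Proof. by move=> [h _] Hx; have := h (-1) _ _ _ _ Hx Hx; rewrite scaleN1r mulN1r !addNr. Qed.

Let good_le0 H r : good H -> H (0, r) -> r = 0.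
Proof.
move=> gH Hr; have le0 s : H (0, s) -> s <= 0.
  by move=> Hs; have [D0 h] := gH.2 _ _ Hs; rewrite (p_zero D0) in h.
have := gH.1 (-1) _ _ _ _ Hr (good0 gH Hr).
rewrite scaler0 addr0 addr0 mulN1r => /le0; have := le0 _ Hr; lra.
Qed.

Let good_fun H x r s : good H -> H (x, r) -> H (x, s) -> r = s.
Proof.
move=> gH Hr Hs; have := gH.1 (-1) _ _ _ _ Hr Hs.
rewrite scaleN1r addNr mulN1r => /(good_le0 gH); lra.
Qed.

Let extend H x0 : good H -> H (0, 0) -> D x0 ->
  exists2 H', good H' & H `<=` H' /\ exists c, H' (x0, c).
Proof.
move=> gH H0 Dx0.
(* The value c at [x0] must lie above every element of [L] and below every [p (y + x0) - s].
   Subadditivity of [p] makes these requirements compatible, and the supremum of [L] is the least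
   choice. *)
pose L := [set q.2 - p (q.1 - x0) | q in H].
have DB x y : D x -> D y -> D (y - x).
  by move=> Dx Dy; rewrite addrC -scaleN1r; apply: D_lin.
have DD x y : D x -> D y -> D (x + y).
  by move=> Dx Dy; rewrite -[x]scale1r; apply: D_lin.
have Lub y s : H (y, s) -> ubound L (p (y + x0) - s).
  move=> Hy _ [[z r] /= Hz <-].
  have [Dy _] := gH.2 _ _ Hy; have [Dz _] := gH.2 _ _ Hz.
  have := gH.1 1 _ _ _ _ Hz Hy; rewrite scale1r mul1r => /(gH.2)[_].
  have := p_add (DB _ _ Dx0 Dz) (DD _ _ Dy Dx0).
  rewrite (_ : z - x0 + (y + x0) = z + y); first lra.
  by rewrite addrACA addNr addr0.
have Lne : L !=set0 by eexists; exists (0, 0).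
have Lh : has_ubound L by eexists; exact: Lub H0.
pose c := sup L.
have c1 y s : H (y, s) -> s + c <= p (y + x0).
  by move=> Hy; have := ge_sup Lne (Lub _ _ Hy); rewrite -/c; lra.
have c2 y s : H (y, s) -> s - c <= p (y - x0).
  move=> Hy; have : s - p (y - x0) <= c by apply: ub_le_sup => //; exists (y, s).
  lra.
exists [set q | exists t : R, exists2 ys, H ys & q = (ys.1 + t *: x0, ys.2 + t * c)].
  split=> [a x y r s [t [[y1 s1] H1 [-> ->]]] [u [[y2 s2] H2 [-> ->]]]|].
    exists (a * t + u); exists (a *: y1 + y2, a * s1 + s2); first exact: gH.1.
    congr pair => /=; last ring.
    by rewrite scalerDr scalerDl scalerA addrACA.
  move=> x r [t [[y s] Hy [-> ->]]] /=.
  have [Dy sy] := gH.2 _ _ Hy.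
  split; first by rewrite addrC; apply: D_lin.
  have Hs (a : R) : H (a *: y, a * s).
    by have := gH.1 a _ _ _ _ Hy H0; rewrite !addr0.
  have [t0|t0|->] := ltgtP t 0; last by rewrite scale0r mul0r !addr0.
  - rewrite (_ : y + t *: x0 = - t *: ((- t)^-1 *: y - x0)); last first.
      by rewrite scalerBr scalerA mulfV ?scale1r ?scaleNr ?opprK// oppr_eq0 lt_eqF.
    have t0' : 0 < - t by rewrite oppr_gt0.
    rewrite p_scale//; last by apply: DB => //; exact: (gH.2 _ _ (Hs _)).1.
    have := c2 _ _ (Hs (- t)^-1); rewrite -(ler_pM2l t0').
    by rewrite mulrBr mulrA mulfV ?gt_eqF// mul1r mulNr opprK.
  - rewrite (_ : y + t *: x0 = t *: (t^-1 *: y + x0)); last first.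
      by rewrite scalerDr scalerA mulfV ?scale1r// gt_eqF.
    rewrite p_scale//; last by apply: DD => //; exact: (gH.2 _ _ (Hs _)).1.
    have := c1 _ _ (Hs t^-1); rewrite -(ler_pM2l t0).
    by rewrite mulrDr mulrA mulfV ?gt_eqF// mul1r.
split=> [[y s] Hy|]; first by exists 0, (y, s) => //=; rewrite scale0r mul0r !addr0.
by exists c, 1, (0, 0) => //=; rewrite scale1r mul1r !add0r.
Qed.

(** Domination is asked only on [D] because it will be applied to [nrm K], which is sublinear only
    among sequences of finite norm. *)
Lemma hahn_banach (Y : set V) (f : V -> R) :
  Y 0 -> Y `<=` D ->
  (forall (c : R) x y, Y x -> Y y -> Y (c *: x + y) /\ f (c *: x + y) = c * f x + f y) ->
  (forall x, Y x -> f x <= p x) ->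
  exists g : V -> R, [/\ forall x, Y x -> g x = f x,
    forall (c : R) x y, D x -> D y -> g (c *: x + y) = c * g x + g y &
    forall x, D x -> g x <= p x].
Proof.
move=> Y0 YD Ylin fp.
pose G0 := [set q | Y q.1 /\ q.2 = f q.1].
have G00 : G0 (0, 0).
  split => //=; have [_] := Ylin (-1) _ _ Y0 Y0.
  by rewrite scaler0 addr0 => h; lra.
have gG0 : good G0.
  split=> [c x y r s [/= Yx ->] [/= Yy ->]|x r [/= Yx ->]].
    by have [? ?] := Ylin c _ _ Yx Yy; split.
  by split; [exact: YD|exact: fp].
(* Zorn's lemma is applied to sets that are good after adjoining the graph [G0] of [f]. In this form
   the empty chain, whose union is empty, is no exception. *)
have [F Fgood Ftot|A [gA Amax]] := @Zorn_bigcup _ [set H | good (H `|` G0)].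
  have join q1 q2 : ((\bigcup_(X in F) X) `|` G0) q1 -> ((\bigcup_(X in F) X) `|` G0) q2 ->
      exists2 H, good H & [/\ H q1, H q2 & H `<=` (\bigcup_(X in F) X) `|` G0].
    have sub X : F X -> X `|` G0 `<=` (\bigcup_(X in F) X) `|` G0.
      by move=> FX; apply: setSU; exact: bigcup_sup.
    move=> [[X FX Xq]|G1] [[X' FX' Xq']|G2].
    - have [XX|XX] := Ftot _ _ FX FX'.
        exists (X' `|` G0); first exact: Fgood.
        by split; [left; exact: XX|left|exact: sub].
      exists (X `|` G0); first exact: Fgood.
      by split; [left|left; exact: XX|exact: sub].
    - by exists (X `|` G0); [exact: Fgood|split; [left|right|exact: sub]].
    - by exists (X' `|` G0); [exact: Fgood|split; [right|left|exact: sub]].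
    - by exists G0 => //; split => //; exact: subsetUr.
  split=> [c x y r s h1 h2|x r h].
    by have [H [gH _] [H1 H2 sH]] := join _ _ h1 h2; apply: sH; exact: gH.
  by have [H [_ gH] [H1 H2 sH]] := join _ _ h h; exact: gH.
pose H := A `|` G0.
have H00 : H (0, 0) by right.
have tot x : D x -> exists r, H (x, r).
  move=> Dx; have [H' gH' [HH' [c H'c]]] := extend gA H00 Dx.
  apply: contrapT => nx; apply: (Amax H'); last first.
    rewrite /= (_ : H' `|` G0 = H') //; apply/seteqP; split; last exact: subsetUl.
    by move=> q [//|G0q]; apply: HH'; right.
  split; last by move=> /(_ _ H'c) Ac; apply: nx; exists c; left.
  by move=> q Aq; apply: HH'; left.
have [x|g gP] := @choice _ _ (fun x r => D x -> H (x, r)).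
  have [Dx|nDx] := pselect (D x); last by exists 0.
  by have [r Hr] := tot _ Dx; exists r.
exists g; split.
- move=> x Yx; apply: (good_fun gA (gP _ (YD _ Yx))); right; split => //.
- move=> c x y Dx Dy; apply: (good_fun gA (gP _ (D_lin c Dx Dy))).
  by apply: gA.1; exact: gP.
- by move=> x Dx; exact: (gA.2 _ _ (gP _ Dx)).2.
Qed.

End HahnBanach.

Lemma hahn_banach_point (R : realType) (V : lmodType R) (p : V -> R) (x0 : V) :
  (forall x y, p (x + y) <= p x + p y) ->
  (forall (c : R) x, 0 < c -> p (c *: x) = c * p x) ->
  exists g : V -> R, [/\ forall (c : R) x y, g (c *: x + y) = c * g x + g y,
    forall x, g x <= p x & g x0 = p x0].
Proof.
move=> pD pZ.
have p0 : p 0 = 0 by have := pZ 2 0 (ltr0n _ 2); rewrite scaler0; lra.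
have [x00|x00] := eqVneq x0 0.
  have [|||g [gY gl gp]] := @hahn_banach R V setT p (fun _ _ _ _ _ => I) (fun x y _ _ => pD x y)
    (fun c x c0 _ => pZ c x c0) [set 0] (fun=> 0) erefl.
  - by [].
  - by move=> c x y -> ->; rewrite scaler0 addr0 mulr0 addr0.
  - by move=> x ->; rewrite p0.
  by exists g; split => [c x y|x|]; [exact: gl|exact: gp|rewrite x00 p0 gY].
pose coef x := xget 0 [set t : R | x = t *: x0].
have coefE t : coef (t *: x0) = t.
  rewrite /coef; case: xgetP => [u _ /= /eqP|/(_ t) h]; last by exfalso; exact: h.
  by rewrite -subr_eq0 -scalerBl scaler_eq0 (negPf x00) orbF subr_eq0 => /eqP.
have [||||g [gY gl gp]] := @hahn_banach R V setT p (fun _ _ _ _ _ => I) (fun x y _ _ => pD x y)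
    (fun c x c0 _ => pZ c x c0) [set x | exists t : R, x = t *: x0]
    (fun x => coef x * p x0); first by exists 0; rewrite scale0r.
- by [].
- move=> c x y [u ->] [v ->]; rewrite /= scalerA -scalerDl !coefE; split; first by eexists.
  by ring.
- move=> x [t ->]; rewrite coefE; have [t0|t0|t0] := ltgtP t 0; last 1 first.
  + by rewrite t0 scale0r mul0r p0.
  (* For negative t, subadditivity gives 0 <= p (t x0) + p (-t x0), that is, t p(x0) <= p (t x0). *)
  + have := pD (t *: x0) (- t *: x0); rewrite -scalerDl subrr scale0r p0 (pZ (- t)) ?oppr_gt0//; lra.
  + by rewrite pZ.
exists g; split => [c x y|x|]; [exact: gl|exact: gp|].
rewrite gY; last by exists 1; rewrite scale1r.
by have := coefE 1; rewrite scale1r => ->; rewrite mul1r.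
Qed.

(** * Elementary facts on continuous functionals and the dual norm *)

Section Dual.
Variables (R : realType) (X : normedModType R).
Implicit Types f g : X -> R.

Definition lin f : Prop := forall (c : R) x y, f (c *: x + y) = c * f x + f y.

Lemma lin0 f : lin f -> f 0 = 0.
Proof. by move=> h; have := h (-1) 0 0; rewrite scaler0 addr0; lra. Qed.

Lemma linZ f c x : lin f -> f (c *: x) = c * f x.
Proof. by move=> h; have := h c x 0; rewrite !addr0 (lin0 h) addr0. Qed.

Lemma linD f x y : lin f -> f (x + y) = f x + f y.
Proof. by move=> h; have := h 1 x y; rewrite scale1r mul1r. Qed.

Lemma linN f x : lin f -> f (- x) = - f x.
Proof. by move=> h; rewrite -scaleN1r linZ // mulN1r. Qed.

Lemma linB f x y : lin f -> f (x - y) = f x - f y.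
Proof. by move=> h; rewrite linD // linN. Qed.

Lemma lin_sum f (I : Type) (r : seq I) (F : I -> X) : lin f ->
  f (\sum_(i <- r) F i) = \sum_(i <- r) f (F i).
Proof.
by move=> h; elim/big_rec2: _ => [|i y1 y2 _ <-]; rewrite ?lin0 ?linD.
Qed.

Lemma dual_lin f : dual_el f -> lin f.
Proof. by case. Qed.

Lemma bounded_dual f M : lin f -> (forall x, `|f x| <= M * `|x|) -> dual_el f.
Proof.
move=> fl fM; split=> // x.
apply/cvgrPdist_lt => e e0.
have M0 : 0 < `|M| + 1 by rewrite ltr_wpDl.
near=> y.
rewrite -linB// (le_lt_trans (fM _))// (@le_lt_trans _ _ ((`|M| + 1) * `|x - y|))//.
  by rewrite ler_wpM2r// (le_trans (ler_norm M))// lerDl.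
rewrite -ltr_pdivlMl// mulrC; near: y; apply: cvgr_dist_lt => //.
by rewrite divr_gt0.
Unshelve. all: by end_near. Qed.

Lemma dual_bounded f : dual_el f -> exists2 M, 0 <= M & forall x, `|f x| <= M * `|x|.
Proof.
move=> [fl fc].
have [d d0 hd] : exists2 d : R, 0 < d & forall x : X, `|x| < d -> `|f x| < 1.
  have := fc 0; move=> /cvgrPdist_lt /(_ 1 ltr01) /nbhs_normP[d /= d0 hd].
  exists d => // x xd; have := hd x; rewrite /= sub0r normrN => /(_ xd).
  by rewrite (lin0 fl) sub0r normrN.
exists (2 / d); first by rewrite divr_ge0// ltW.
move=> x; have [->|x0] := eqVneq x 0; first by rewrite (lin0 fl) !normr0 mulr0.
have nx : 0 < `|x| by rewrite normr_gt0.
have c0 : 0 < d / 2 / `|x| by rewrite !divr_gt0.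
have yd : `|(d / 2 / `|x|) *: x| < d.
  by rewrite normrZ gtr0_norm// mulfVK ?gt_eqF//; lra.
have := hd _ yd; rewrite linZ// normrM (gtr0_norm c0) -ltr_pdivlMl// mulr1.
by move=> /ltW/le_trans; apply; rewrite !invfM !invrK (mulrC _ 2).
Qed.

Lemma dnorm_le f M : 0 <= M -> (forall x, `|f x| <= M * `|x|) -> dnorm f <= M.
Proof.
move=> M0 fM; apply: ge_sup; first by exists `|f 0|, 0 => //=; rewrite normr0.
move=> _ [x /= x1 <-]; apply: le_trans (fM x) _; by rewrite ler_piMr.
Qed.

Lemma dnorm_ubP f x : dual_el f -> `|x| <= 1 -> `|f x| <= dnorm f.
Proof.
move=> /dual_bounded[M M0 fM] x1; apply: ub_le_sup; last by exists x.
by exists M => _ [y /= y1 <-]; apply: le_trans (fM y) _; rewrite ler_piMr.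
Qed.

Lemma dnorm_ge0 f : dual_el f -> 0 <= dnorm f.
Proof. by move=> fd; apply: le_trans (dnorm_ubP (x := 0) fd _); rewrite ?normr0. Qed.

Lemma dual_bound f x : dual_el f -> `|f x| <= dnorm f * `|x|.
Proof.
move=> fd; have fl := dual_lin fd.
have [->|x0] := eqVneq x 0; first by rewrite (lin0 fl) !normr0 mulr0.
have nx : 0 < `|x| by rewrite normr_gt0.
have := dnorm_ubP (x := `|x|^-1 *: x) fd; rewrite normfZV// => /(_ (lexx _)).
by rewrite (linZ _ _ fl) normrM normfV normr_id ler_pdivrMl// mulrC.
Qed.

Lemma dual_comb (c : R) f g : dual_el f -> dual_el g -> dual_el (fun x => c * f x + g x).
Proof.
move=> fd gd; apply: (@bounded_dual _ (`|c| * dnorm f + dnorm g)).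
  by move=> d x y; rewrite (dual_lin fd) (dual_lin gd); ring.
move=> x; rewrite (le_trans (ler_normD _ _))// mulrDl lerD ?dual_bound//.
by rewrite normrM -mulrA ler_wpM2l// dual_bound.
Qed.

Lemma dual_zero : dual_el (fun _ : X => 0 : R).
Proof.
apply: (@bounded_dual _ 0); first by move=> c x y; rewrite mulr0 addr0.
by move=> x; rewrite normr0 mul0r.
Qed.

Lemma dual_opp f : dual_el f -> dual_el (fun x => - f x).
Proof.
move=> fd; rewrite (_ : (fun _ => _) = fun x => -1 * f x + 0); last first.
  by apply/funext => x; rewrite mulN1r addr0.
exact: (dual_comb (-1) fd dual_zero).
Qed.

Lemma norming_functional (x0 : X) : exists phi : X -> R,
  [/\ dual_el phi, forall x, `|phi x| <= `|x| & phi x0 = `|x0|].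
Proof.
have [||g [gl gp gx]] := @hahn_banach_point R X (fun x => `|x|) x0.
- by move=> x y; exact: ler_normD.
- by move=> c x c0; rewrite normrZ gtr0_norm.
have gb x : `|g x| <= `|x|.
  by rewrite ler_norml gp andbT lerNl -linN// -[leRHS]normrN gp.
by exists g; split => //; apply: (@bounded_dual _ 1) => // x; rewrite mul1r.
Qed.

Lemma separable_span (y : nat -> X) : (forall i, `|y i| <= 1) ->
  (forall z (e : R), 0 < e -> exists a : nat -> R, exists n,
     `|z - \sum_(i < n) a i *: y i| < e) ->
  separable X.
Proof.
move=> y1 dense.
exists (range (fun s : seq rat => \sum_(i < size s) (ratr s`_i : R) *: y i)); split.
  by apply: (card_le_trans (card_image_le _ _)); exact: countableP.
apply/seteqP; split=> // z _ B /nbhs_normP[e /= e0 eB].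
have [a [n za]] := dense z _ (divr_gt0 e0 (ltr0n _ 2)).
(* Each of the n coefficients may err by this much, since the vectors have norm at most 1. The
   denominator n + 1 covers n = 0. *)
have d0 : 0 < e / 2 / n.+1%:R by rewrite divr_gt0// divr_gt0.
have [q qa] : {q : nat -> rat & forall i, `|a i - ratr (q i)| < e / 2 / n.+1%:R}.
  apply: (@choice _ _ (fun i (q : rat) => `|a i - ratr q| < e / 2 / n.+1%:R)) => i.
  have [|q] := @rat_in_itvoo R (a i) (a i + e / 2 / n.+1%:R); first by rewrite ltrDl.
  rewrite in_itv /= => /andP[q1 q2]; exists q.
  by move: q1 q2; set d := _ / _; rewrite ltr_norml => q1 q2; apply/andP; split; lra.
exists (\sum_(i < n) (ratr (q i) : R) *: y i); split.
  exists (mkseq q n) => //; rewrite size_mkseq; apply: eq_bigr => i _.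
  by rewrite nth_mkseq.
apply: eB => /=.
rewrite -(subrK (\sum_(i < n) a i *: y i) z) -addrA (le_lt_trans (ler_normD _ _))//.
rewrite [e]splitr ltr_leD// -sumrB (le_trans (ler_norm_sum _ _ _))//.
apply: (@le_trans _ _ (\sum_(i < n) e / 2 / n.+1%:R)).
  apply: ler_sum => i _; rewrite -scalerBl normrZ -[leRHS]mulr1.
  by apply: ler_pM => //; exact: ltW.
rewrite sumr_const card_ord -[leLHS]mulr_natr mulrAC ler_pdivrMr// ler_wpM2l//.
  by rewrite divr_ge0// ltW.
by rewrite ler_nat.
Qed.

End Dual.

(** * From a separable dual to a sequence of directions in the unit ball *)

Section Separability.
Variables (R : realType) (X : normedModType R).

(** Hahn-Banach at [z] for the distance to [Y]: a sublinear function below the norm, zero on [Y],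
    and at least [e] at [z]. *)
Lemma annihilator_exists (Y : set X) (z : X) (e : R) : Defs.subspace Y -> 0 < e ->
  (forall s, Y s -> e <= `|z - s|) ->
  exists f : X -> R, [/\ dual_el f, forall s, Y s -> f s = 0 & 0 < f z].
Proof.
move=> [Y0 Ylin] e0 far.
pose E x := [set `|x - s| | s in Y].
have Ene x : E x !=set0 by exists `|x - 0|; exists 0.
have Elb x : has_lbound (E x) by exists 0 => _ [s _ <-].
pose p x := inf (E x).
have p_le x s : Y s -> p x <= `|x - s| by move=> Ys; apply: ge_inf => //; exists s.
have p_lt x r : p x < r -> exists2 s, Y s & `|x - s| < r.
  by move=> /(inf_lt (Ene x))[_ [s Ys <-] sr]; exists s.
have pD x y : p (x + y) <= p x + p y.
  apply/ler_addgt0Pr => d d0.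
  have [s Ys sx] : exists2 s, Y s & `|x - s| < p x + d / 2 by apply: p_lt; rewrite ltrDl divr_gt0.
  have [t Yt ty] : exists2 s, Y s & `|y - s| < p y + d / 2 by apply: p_lt; rewrite ltrDl divr_gt0.
  have := p_le (x + y) (1 *: s + t) (Ylin _ _ _ Ys Yt).
  rewrite scale1r opprD addrACA => /le_trans; apply.
  by apply: le_trans (ler_normD _ _) _; lra.
have pZ_le (c : R) x : 0 < c -> p (c *: x) <= c * p x.
  move=> c0; rewrite -ler_pdivrMl//; apply/ler_addgt0Pr => d d0.
  have [s Ys sx] : exists2 s, Y s & `|x - s| < p x + d by apply: p_lt; rewrite ltrDl.
  have := p_le (c *: x) (c *: s + 0) (Ylin _ _ _ Ys Y0).
  rewrite addr0 -scalerBr normrZ gtr0_norm// -ler_pdivrMl// => /le_trans; apply.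
  exact: ltW.
have pZ (c : R) x : 0 < c -> p (c *: x) = c * p x.
  move=> c0; apply/eqP; rewrite eq_le pZ_le//= -ler_pdivlMl//.
  rewrite -[x in p x <= _](scale1r x) -(mulVf (lt0r_neq0 c0)) -scalerA.
  by apply: pZ_le; rewrite invr_gt0.
have [f [fl fp fz]] := hahn_banach_point z pD pZ.
have pn x : p x <= `|x| by have := p_le x 0 Y0; rewrite subr0.
exists f; split.
- apply: (@bounded_dual _ _ _ 1) => // x; rewrite mul1r ler_norml.
  rewrite (le_trans (fp x) (pn x)) andbT lerNl -linN// -[leRHS]normrN.
  exact: le_trans (fp _) (pn _).
- have h s : Y s -> f s <= 0.
    by move=> Ys; have := p_le s s Ys; rewrite subrr normr0; exact: le_trans.
  move=> s Ys; apply/eqP; rewrite eq_le h//= -oppr_le0 -linN//; apply: h.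
  by have := Ylin (-1) _ _ Ys Y0; rewrite scaleN1r addr0.
- rewrite fz; apply: lt_le_trans e0 _; apply: lb_le_inf; first exact: Ene.
  by move=> _ [s Ys <-]; exact: far.
Qed.

Lemma half_norming (f : X -> R) : dual_el f ->
  exists2 x : X, `|x| <= 1 & dnorm f / 2 <= `|f x|.
Proof.
move=> fd; apply: contrapT => h.
have lt x : `|x| <= 1 -> `|f x| < dnorm f / 2.
  by move=> x1; rewrite ltNge; apply/negP => hx; apply: h; exists x.
have : dnorm f <= dnorm f / 2.
  by apply: ge_sup => [|_ [x /= x1 <-]]; [exists `|f 0|; exists 0; rewrite /= ?normr0|exact/ltW/lt].
by have := lt 0; rewrite normr0 (lin0 (dual_lin fd)) normr0 => /(_ ler01); lra.
Qed.

Definition span_seq (y : nat -> X) : set X :=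
  [set z | exists a : nat -> R, exists n, z = \sum_(i < n) a i *: y i].

Lemma span_seq_subspace (y : nat -> X) : Defs.subspace (span_seq y).
Proof.
split; first by exists (fun=> 0), 0%N; rewrite big_ord0.
move=> c _ _ [a [n ->]] [b [m ->]].
exists (fun i => c * res 0 n a i + res 0 m b i), (maxn n m).
have E (d : nat -> R) k : (k <= maxn n m)%N ->
    \sum_(i < k) d i *: y i = \sum_(i < maxn n m) res 0 k d i *: y i.
  move=> km; rewrite -(big_mkord xpredT (fun i => d i *: y i)).
  rewrite -(big_mkord xpredT (fun i => res 0 k d i *: y i)).
  rewrite -(@sum_mask_sub _ (fun i => d i *: y i) 0 k 0 (maxn n m))//.
  by apply: eq_bigr => i _; rewrite /res; case: ifP => // _; rewrite scale0r.
rewrite (E a n) ?leq_maxl// (E b m) ?leq_maxr// scaler_sumr -big_split.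
by apply: eq_bigr => i _ /=; rewrite scalerDl scalerA.
Qed.

(** Choose for each [g] in the dense set a point of the unit ball at which [g] attains half its
    norm. If [f] vanishes on the span of these points and [g] is within a quarter of the norm of
    [f], then |g| <= 2 |f - g| < |f| / 2, so |f| < 3/4 |f|. Hence no nonzero functional vanishes on
    the span, which is therefore dense. *)
Lemma dual_separable_separable : dual_separable X -> separable X.
Proof.
move=> [D [cD [Ddual Ddense]]].
have /countable_injP[code codeI] := cD.
have [n|y yP] := @choice _ _ (fun n (x : X) => `|x| <= 1 /\
    forall g, D g -> code g = n -> dnorm g / 2 <= `|g x|).
  have [[g [Dg gn]]|none] := pselect (exists g, D g /\ code g = n).
    have [x x1 gx] := half_norming (Ddual _ Dg).
    exists x; split => // h Dh hn; rewrite (codeI h g) ?inE// hn gn//.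
  by exists 0; rewrite normr0; split => // g Dg gn; exfalso; apply: none; exists g.
apply: (@separable_span _ _ y) => [i|z e e0]; first exact: (yP i).1.
apply: contrapT => far.
have [s [a [n ->]]|f [fd fY fz]] := @annihilator_exists (span_seq y) z e (span_seq_subspace y) e0.
  by rewrite leNgt; apply/negP => h; apply: far; exists a, n.
have f0 : 0 < dnorm f.
  rewrite lt_neqAle dnorm_ge0// andbT eq_sym; apply/eqP => f0.
  by have := dual_bound z fd; rewrite f0 mul0r normr_le0 gt_eqF.
have [g Dg fg] := Ddense _ fd _ (divr_gt0 f0 (ltr0n _ 4)).
have gd := Ddual _ Dg; have [y1 /(_ g Dg erefl) gy] := yP (code g).
have fgd : dual_el (fun x => f x - g x).
  have := dual_comb (-1) gd fd; congr dual_el.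
  by apply/funext => x; ring.
have fy : f (y (code g)) = 0.
  apply: fY; exists (unit_seq R (code g)), (code g).+1.
  rewrite (bigD1 ord_max)//= /unit_seq eqxx scale1r big1 ?addr0// => i.
  by rewrite -val_eqE /= => /negPf ->; rewrite scale0r.
have gle : `|g (y (code g))| <= dnorm (fun x => f x - g x).
  by have := dnorm_ubP fgd y1; rewrite fy sub0r normrN.
have : dnorm f <= dnorm (fun x => f x - g x) + dnorm g.
  apply: dnorm_le => [|x]; first by rewrite addr_ge0// dnorm_ge0.
  rewrite -[f x](subrK (g x)) (le_trans (ler_normD _ _))// mulrDl.
  by apply: lerD; [exact: (dual_bound x fgd)|exact: dual_bound].
lra.
Qed.

(* The dyadic valuation of the index repeats every point of [D] infinitely often. *)
Lemma separable_ball_seq : separable X -> exists x : nat -> X,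
  (forall i, `|x i| <= 1) /\
  forall y n (e : R), 0 < e -> exists2 i, (n <= i)%N & `| `|y| *: x i - y| < e.
Proof.
move=> [D [/countable_injP[code codeI] Ddense]].
have [n|d dP] := @choice _ _ (fun n (x : X) => forall g, D g -> code g = n -> x = g).
  have [[g [Dg gn]]|none] := pselect (exists g, D g /\ code g = n).
    by exists g => h Dh hn; apply: codeI; rewrite ?inE// hn gn.
  by exists 0 => g Dg gn; exfalso; apply: none; exists g.
(* Radial retraction onto the unit ball. It moves a point g by at most | |g| - 1 |, which is at most
   |u - g| for any unit vector u, so approximations of unit vectors survive. *)
pose m v : R := Num.max 1 `|d v|.
have m0 v : 0 < m v by rewrite lt_max ltr01.
pose x i := (m (logn 2 i))^-1 *: d (logn 2 i).
exists x; split=> [i|y n e e0].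
  by rewrite normrZ gtr0_norm ?invr_gt0// ler_pdivrMl// mulr1 le_max lexx orbT.
have [->|y0] := eqVneq y 0; first by exists n => //; rewrite normr0 scale0r subrr normr0.
have ny : 0 < `|y| by rewrite normr_gt0.
pose u := `|y|^-1 *: y.
have u1 : `|u| = 1 by apply: normfZV.
have h0 : 0 < e / 2 / `|y| by rewrite !divr_gt0.
have [g [Dg gu]] : exists g, D g /\ `|u - g| < e / 2 / `|y|.
  have : closure D u by rewrite Ddense.
  move=> /(_ (ball u (e / 2 / `|y|))) []; first exact: nbhsx_ballx.
  by move=> g [Dg]; rewrite -ball_normE => ug; exists g.
(* The odd factor carries the index beyond n without changing its valuation. *)
exists (2 ^ code g * (2 * n).+1)%N.
  by rewrite (leq_trans _ (leq_pmull _ _)) ?expn_gt0// mul2n -addnn ltnW// ltnS leq_addr.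
have lg : logn 2 (2 ^ code g * (2 * n).+1) = code g.
  rewrite lognM ?expn_gt0// pfactorK// lognE /= dvdn2 /= mul2n odd_double /= addn0//.
rewrite /x lg (dP _ g Dg erefl) (_ : m _ = Num.max 1 `|g|); last by rewrite /m (dP _ g).
have yu : y = `|y| *: u by rewrite scalerA mulfV ?scale1r// gt_eqF.
rewrite [X in _ - X]yu -scalerBr normrZ normr_id -ltr_pdivlMl//.
set M := Num.max _ _.
rewrite (_ : M^-1 *: g - u = (M^-1 *: g - g) + (g - u)); last by rewrite addrA subrK.
apply: le_lt_trans (ler_normD _ _) _; rewrite (distrC g).
suff : `|M^-1 *: g - g| <= `|u - g|.
  by move: gu; rewrite mulrAC => ? ?; rewrite (_ : _^-1 * e = e / `|y| / 2 + e / `|y| / 2); [lra|field; rewrite gt_eqF].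
rewrite /M; have [g1|g1] := leP `|g| 1.
  by rewrite invr1 scale1r subrr normr0.
have g0 : 0 < `|g| by apply: lt_trans g1.
rewrite -[X in _ - X]scale1r -scalerBl normrZ -[X in _ * X](gtr0_norm g0) -normrM.
rewrite mulrBl mulVf ?gt_eqF// mul1r -{1}u1; exact: ler_dist_dist.
Qed.

End Separability.

(** * Partial sums of vectors and combinations of successive blocks *)

Section VectorSums.
Variables (R : comPzRingType) (V : lmodType R).
Implicit Types (y : nat -> V) (a b : nat -> R).

Definition vsum y a s t : V := \sum_(s <= i < t) a i *: y i.

Lemma vsum_lin y c a b s t :
  vsum y (fun i => c * a i + b i) s t = c *: vsum y a s t + vsum y b s t.
Proof.
rewrite /vsum scaler_sumr -big_split; apply: eq_bigr => i _ /=.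
by rewrite scalerDl scalerA.
Qed.

Lemma vsumZ y c a s t : vsum y (fun i => c * a i) s t = c *: vsum y a s t.
Proof. by rewrite /vsum scaler_sumr; apply: eq_bigr => i _; rewrite scalerA. Qed.

Lemma vsumB y a b s t : vsum y (fun i => a i - b i) s t = vsum y a s t - vsum y b s t.
Proof. by rewrite /vsum -sumrB; apply: eq_bigr => i _; rewrite scalerBl. Qed.

Lemma vsum_res y a s t s' t' :
  vsum y (res s t a) s' t' = vsum y a (maxn s s') (minn t t').
Proof.
rewrite /vsum -sum_mask; apply: eq_bigr => i _; rewrite /res.
by case: ifP => // _; rewrite scale0r.
Qed.

Lemma vsum_cat y a s t r : (s <= t)%N -> (t <= r)%N ->
  vsum y a s r = vsum y a s t + vsum y a t r.
Proof. by move=> st tr; rewrite /vsum (big_cat_nat st tr). Qed.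

Lemma vsum_geq y a s t : (t <= s)%N -> vsum y a s t = 0.
Proof. by move=> ts; rewrite /vsum big_geq. Qed.

Lemma vsum_blocks y n (p : nat -> nat) (c : nat -> R) (u : nat -> nat -> R) s N :
  (forall j, (p j <= p j.+1)%N) -> (s <= p 0)%N -> (p n <= N)%N ->
  vsum y (fun i => \sum_(j < n) c j * res (p j) (p j.+1) (u j) i) s N =
  \sum_(j < n) c j *: vsum y (u j) (p j) (p j.+1).
Proof.
move=> pS sp pN; have pm : {homo p : i j / (i <= j)%N}.
  by apply: homo_leq => //; exact: leq_trans.
rewrite /vsum; under eq_bigr do rewrite scaler_suml.
rewrite exchange_big; apply: eq_bigr => j _ /=.
under eq_bigr do rewrite -scalerA.
rewrite -scaler_sumr; congr (_ *: _).
rewrite -[LHS]/(vsum y (res (p j) (p j.+1) (u j)) s N) vsum_res.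
rewrite (maxn_idPl _) ?(leq_trans sp) ?pm// (minn_idPl _)//.
by apply: leq_trans pN; exact: pm.
Qed.

End VectorSums.

Lemma pair_blocks (R : comPzRingType) (g : nat -> R) n (p : nat -> nat) (c : nat -> R) (u : nat -> nat -> R) s N :
  (forall j, (p j <= p j.+1)%N) -> (s <= p 0)%N -> (p n <= N)%N ->
  pair_ g (fun i => \sum_(j < n) c j * res (p j) (p j.+1) (u j) i) s N =
  \sum_(j < n) c j * pair_ g (u j) (p j) (p j.+1).
Proof.
(* A pairing is a vector sum in [R^o], the scalars [g i] playing the vectors. *)
move=> pS sp pN; rewrite pairC; apply: (etrans (@vsum_blocks R R^o g n p c u s N pS sp pN)).
by apply: eq_bigr => j _; rewrite pairC.
Qed.

Lemma pair_geq (R : pzRingType) (g a : nat -> R) s t : (t <= s)%N -> pair_ g a s t = 0.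
Proof. by move=> ts; rewrite /pair_ big_geq. Qed.

(** Successive intervals are disjoint. The bound [i < p n], sharper than 1, is what the induction
    carries. *)
Lemma block_count (p : nat -> nat) i n : (forall j, (p j <= p j.+1)%N) ->
  (\sum_(j < n) (p j <= i < p j.+1) <= (i < p n))%N.
Proof.
move=> pS; elim: n => [|n IH]; first by rewrite big_ord0.
rewrite big_ord_recr /= (leq_trans (leq_add IH (leqnn _)))//.
by have := pS n; case: (ltnP i (p n)) => h1; case: (ltnP i (p n.+1)) => h2 //= h3;
   have := leq_trans h1 (leq_trans h3 h2); rewrite ltnn.
Qed.

(** * Norming sets stable under truncation, and polarity *)

Section MaskClosed.
Variables (R : realType) (A : set (nat -> R)).
Hypothesis A_res : forall g s t, A g -> A (res s t g).

Lemma pair_bd M a g s t : bd A M a -> A g -> `|pair_ g a s t| <= M.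
Proof.
move=> aM Ag; have := aM _ (maxn s t) (A_res s t Ag).
by rewrite -pair_resC pair_res_sub ?leq_maxr.
Qed.

Lemma bd_res M a s t : bd A M a -> bd A M (res s t a).
Proof. by move=> aM g n Ag; rewrite pair_resC; apply: aM; exact: A_res. Qed.

Lemma bd_tail M a s : bd A M a -> bd A M (tail s a).
Proof. by move=> aM g n Ag; rewrite pair_tail pair_bd. Qed.

Lemma bd_pairP M a s : (forall g n, A g -> (s <= n)%N -> `|pair_ g a s n| <= M) ->
  0 <= M -> bd A M (tail s a).
Proof.
move=> h M0 g n Ag; rewrite pair_tail.
by have [sn|/ltnW ns] := leqP s n; [exact: h|rewrite pair_geq// normr0].
Qed.

Lemma polar_pair M G a N s t : bd (polar A) M G -> 0 <= M -> 0 <= N ->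
  bd A N a -> `|pair_ G a s t| <= M * N.
Proof.
move=> GM M0 N0 aN; apply/ler_addgt0Pr => e e0.
(* As [N] may be 0, the vector is divided by N + e/(M+1) instead; this costs M e/(M+1) <= e. *)
have M1 : 0 < M + 1 by rewrite ltr_wpDl.
have N1 : 0 < N + e / (M + 1) by rewrite ltr_wpDl// divr_gt0.
have ua : polar A (fun i => (N + e / (M + 1))^-1 * res s t a i).
  apply: (bd_le _ (bdZ _ (bd_res s t aN))).
  by rewrite gtr0_norm ?invr_gt0// ler_pdivrMl// mulr1 lerDl divr_ge0// ltW.
have := GM _ (maxn s t) ua; rewrite pairZl normrM gtr0_norm ?invr_gt0//.
rewrite ler_pdivrMl// -pair_resC pair_res_sub ?leq_maxr// pairC => /le_trans; apply.
rewrite mulrDl mulrC lerD// mulrAC ler_pdivrMr// ler_wpM2l ?ltW//.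
by rewrite ltrDl.
Qed.

End MaskClosed.

(** * The Tsirelson-type norming set and bounded completeness *)

Section NormingSet.
Variables (R : realType) (X : completeNormedModType R) (x : nat -> X).
Hypothesis x_le1 : forall i, `|x i| <= 1.

(* Norming functionals of a Tsirelson-type space: [K_block] makes
   [a |-> \sum_i a i *: x i] a contraction, [K_step] makes the basis boundedly
   complete and asymptotically l_1. *)
Inductive K : (nat -> R) -> Prop :=
| K_coord c k : `|c| <= 1 -> K (fun i => c * unit_seq R k i)
| K_block (phi : X -> R) s t : dual_el phi -> (forall y, `|phi y| <= `|y|) ->
    K (res s t (fun i => phi (x i)))
| K_step n (p : nat -> nat) (g : nat -> nat -> R) :
    (n <= p 0)%N -> (forall j, (p j <= p j.+1)%N) -> (forall j, K (g j)) ->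
    K (fun i => \sum_(j < n) 2^-1 * res (p j) (p j.+1) (g j) i).

Lemma K_unit k : K (unit_seq R k).
Proof.
rewrite (_ : unit_seq R k = fun i => 1 * unit_seq R k i); last by apply/funext => i; rewrite mul1r.
by apply: K_coord; rewrite normr1.
Qed.

Lemma K_zero : K (fun=> 0).
Proof.
rewrite (_ : (fun _ => _) = fun i => 0 * unit_seq R 0 i); last by apply/funext => i; rewrite mul0r.
by apply: K_coord; rewrite normr0.
Qed.

Lemma K_neg g : K g -> K (fun i => - g i).
Proof.
elim=> [c k c1|phi s t phid phi1|n p h np pS _ IH].
- rewrite (_ : (fun _ => _) = fun i => (- c) * unit_seq R k i); last by apply/funext => i; rewrite mulNr.
  by apply: K_coord; rewrite normrN.
- rewrite (_ : (fun _ => _) = res s t (fun i => - phi (x i))); last first.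
    by apply/funext => i; rewrite /res; case: ifP => // _; rewrite oppr0.
  by apply: (K_block _ _ (dual_opp phid)) => y; rewrite normrN.
- rewrite (_ : (fun _ => _) = fun i => \sum_(j < n) 2^-1 * res (p j) (p j.+1) (fun k => - h j k) i).
    exact: (K_step np pS IH).
  apply/funext => i; rewrite -sumrN; apply: eq_bigr => j _.
  by rewrite /res; case: ifP => _; rewrite ?mulr0 ?oppr0 ?mulrN.
Qed.

Lemma K_res g s t : K g -> K (res s t g).
Proof.
move=> Kg; elim: Kg => [c k c1|phi s' t' phid phi1|n p h np pS _ IH].
- have [skt|skt] := boolP (s <= k < t)%N.
    rewrite (_ : res s t _ = fun i => c * unit_seq R k i); first exact: K_coord.
    apply/funext => i; rewrite /res /unit_seq; have [->|] := eqVneq i k; first by rewrite skt.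
    by rewrite mulr0 if_same.
  rewrite (_ : res s t _ = fun=> 0); first exact: K_zero.
  apply/funext => i; rewrite /res /unit_seq; have [->|] := eqVneq i k.
    by rewrite (negPf skt).
  by rewrite mulr0 if_same.
- rewrite (_ : res s t _ = res (maxn s s') (minn t t') (fun i => phi (x i))); first exact: K_block.
  apply/funext => i; rewrite /res geq_max leq_min.
  by do ![case: leqP => _ //=].
- rewrite (_ : res s t _ = fun i => \sum_(j < n) 2^-1 * res (p j) (p j.+1) (res s t (h j)) i).
    exact: (K_step np pS IH).
  apply/funext => i; rewrite /res; case: ifP => // _; rewrite big1 // => j _.
  by rewrite if_same mulr0.
Qed.

(** In the [K_step] case at most one block contains [i]. Dually, this puts the unit vectors in the
    unit ball. *)
Lemma K_coord_le1 g i : K g -> `|g i| <= 1.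
Proof.
move=> Kg; elim: Kg => [c k c1|phi s t phid phi1|n p h np pS _ IH].
- by rewrite /unit_seq; case: ifP => _; rewrite ?mulr1 ?mulr0 ?normr0.
- by rewrite /res; case: ifP => _; rewrite ?normr0// (le_trans (phi1 _)).
- rewrite (le_trans (ler_norm_sum _ _ _))//.
  apply: (@le_trans _ _ (\sum_(j < n) (p j <= i < p j.+1)%:R)).
    apply: ler_sum => j _; rewrite normrM gtr0_norm ?invr_gt0 ?ltr0n// /res.
    by case: ifP => _; rewrite ?normr0 ?mulr0//; have := IH j; rewrite /= ?mulr1n; lra.
  rewrite -natr_sum (@le_trans _ _ ((i < p n)%N%:R))//; first by rewrite ler_nat block_count.
  by case: (_ < _)%N.
Qed.

Lemma polar_unit k : polar K (unit_seq R k).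
Proof.
move=> g n Kg; rewrite pairC.
have [kn|nk] := ltnP k n; first by rewrite pair_unit// K_coord_le1.
rewrite /pair_ big_nat_cond big1 ?normr0// => i /andP[/andP[_ ik] _].
by rewrite /unit_seq ltn_eqF ?mul0r// (leq_trans ik).
Qed.

Lemma pairK_bd M a g s t : bd K M a -> K g -> `|pair_ g a s t| <= M.
Proof. by apply: pair_bd => h ? ?; apply: K_res. Qed.

Lemma bdK_res M a s t : bd K M a -> bd K M (res s t a).
Proof. by apply: bd_res => h ? ?; apply: K_res. Qed.

Lemma bdK_tail M a s : bd K M a -> bd K M (tail s a).
Proof. by apply: bd_tail => h ? ?; apply: K_res. Qed.

Lemma polarK_res u s t : polar K u -> polar K (res s t u).
Proof. exact: bdK_res. Qed.

Lemma dualK_pair M G a N s t : bd (polar K) M G -> bd K N a -> `|pair_ G a s t| <= M * N.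
Proof.
move=> GM aN; apply: (polar_pair (A := K)) => //.
- by move=> h ? ?; exact: K_res.
- by have := bd_ge0 polar_unit GM.
- by have := bd_ge0 K_unit aN.
Qed.

(** A norming functional of the image, cut to [s, t), is a [K_block] functional: Q is a
    contraction. *)
Lemma vsum_bd M a s t : bd K M a -> `|vsum x a s t| <= M.
Proof.
move=> aM; have [phi [phid phi1 <-]] := norming_functional (vsum x a s t).
rewrite /vsum lin_sum; last exact: dual_lin.
have := pairK_bd 0 (maxn s t) aM (K_block s t phid phi1).
rewrite -pair_resC pair_res_sub ?leq_maxr// => h.
rewrite (le_trans (ler_norm _))//; apply: le_trans h; rewrite le_eqVlt; apply/orP; left; apply/eqP.
by congr (`|_|); apply: eq_bigr => i _; rewrite (linZ _ _ (dual_lin phid)) mulrC.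
Qed.

(** The lower l_1 estimate. [K] is symmetric, so signs can be chosen to make all terms nonnegative,
    and 2 undoes the factor 1/2 of [K_step]. *)
Lemma step_bd M a n p (g : nat -> nat -> R) : (n <= p 0)%N -> (forall j, (p j <= p j.+1)%N) ->
  (forall j, K (g j)) -> bd K M a ->
  \sum_(j < n) `|pair_ (g j) a (p j) (p j.+1)| <= 2 * M.
Proof.
move=> np pS Kg aM.
pose h j := if 0 <= pair_ (g j) a (p j) (p j.+1) then g j else fun i => - g j i.
have Kh j : K (h j) by rewrite /h; case: ifP => // _; exact: K_neg.
have := pairK_bd 0 (p n) aM (K_step np pS Kh).
rewrite pairC (pair_blocks _ (fun=> 2^-1))//.
rewrite (eq_bigr (fun j : 'I_n => 2^-1 * `|pair_ (g j) a (p j) (p j.+1)|)) => [|j _].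
  rewrite -mulr_sumr => /ler_normlW; lra.
congr (_ * _); rewrite pairC /h; case: ifPn => [h0|]; first by rewrite ger0_norm.
by rewrite -ltNge pairN => h0; rewrite ltr0_norm.
Qed.

(** If all tails exceeded [e], there would be, for every N, N successive blocks beyond N each paired
    above [e] with some element of [K]. Then [step_bd] gives N e <= 2 M for all N, which is
    absurd. *)
Lemma boundedly_complete M a (e : R) : bd K M a -> 0 < e -> exists n, bd K e (tail n a).
Proof.
move=> aM e0; apply: contrapT => none.
have far n : exists mg : nat * (nat -> R), [/\ (n <= mg.1)%N, K mg.2 & e < `|pair_ mg.2 a n mg.1|].
  apply: contrapT => h; apply: none; exists n; apply: bd_pairP (ltW e0) => g m Kg nm.
  by rewrite leNgt; apply/negP => lt; apply: h; exists (m, g).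
have [f fP] := choice far.
pose p N j := iter j (fun n => (f n).1) N.
have pS N j : (p N j <= p N j.+1)%N by have [] := fP (p N j).
have M0 : 0 <= M := bd_ge0 K_unit aM.
have big N : N%:R * e <= 2 * M.
  apply: le_trans (@step_bd M a N (p N) (fun j => (f (p N j)).2) (leqnn _) (pS N) _ aM).
    rewrite -[N in leLHS]card_ord mulr_natl -sumr_const; apply: ler_sum => j _.
    by have [_ _ /ltW] := fP (p N j).
  by move=> j; have [] := fP (p N j).
have := big (Num.truncn (2 * M / e)).+1.
rewrite -ler_pdivlMr// leNgt => /negP; apply.
by have := real_truncnS_gt (num_real (2 * M / e)).
Qed.

End NormingSet.

(** * Functionals on W1 are small on far-out vectors with small image *)

Section FlatFunctionals.
Variables (R : realType) (X : completeNormedModType R) (x : nat -> X).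
Hypothesis x_le1 : forall i, `|x i| <= 1.
Notation K := (K x).

(* Either [g] does not see the first block [0, E), or [g] is cut at few points,
   and only the blocks containing one of them contribute more than 1/2. *)
Lemma K_cuts g E : K g -> (forall i, (i < E)%N -> g i = 0) \/
  exists2 L : seq nat, (size L <= E + 2)%N & forall v s t, (E <= s)%N -> polar K v ->
    `|vsum x v s t| <= 4^-1 -> (forall q, q \in L -> ~~ (s <= q < t)%N) ->
    `|pair_ g v s t| <= 2^-1.
Proof.
case=> [c k c1|phi a b phid phi1|n p h np pS Kh].
- right; exists [:: k] => [|v s t _ _ _ /(_ k (mem_head _ _)) kst]; first by rewrite addnC.
  rewrite pairZl normrM (_ : pair_ _ _ _ _ = 0) ?normr0 ?mulr0//.
  rewrite /pair_ big_nat_cond big1 // => i /andP[ist _].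
  rewrite /unit_seq ifF ?mul0r//; apply/eqP => ik; by rewrite -ik ist in kst.
(* An interval containing neither end point is disjoint from [a, b) or inside it. In the second case
   the pairing is [phi] of the image of [v], at most 1/4. *)
- right; exists [:: a; b] => [|v s t _ _ vQ nab]; first by rewrite addnC.
  have /nandP na := nab a (mem_head _ _).
  have /nandP nb : ~~ (s <= b < t)%N by apply: nab; rewrite !inE eqxx orbT.
  rewrite pairC pair_res pairC; case: (leqP (minn b t) (maxn a s)) => [?|].
    by rewrite pair_geq// normr0 invr_ge0.
  rewrite gtn_max !ltn_min => /andP[/andP[ab at_] /andP[sb st]].
  have sa : (a < s)%N by case: na; rewrite ?at_// -ltnNge.
  have tb : (t <= b)%N by case: nb; [rewrite (ltnW sb)|rewrite -leqNgt].
  rewrite (maxn_idPr (ltnW sa)) (minn_idPr tb).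
  have -> : pair_ (fun i => phi (x i)) v s t = phi (vsum x v s t).
    rewrite /vsum (lin_sum _ _ (dual_lin phid)); apply: eq_bigr => i _.
    by rewrite (linZ _ _ (dual_lin phid)) mulrC.
  by rewrite (le_trans (phi1 _))// (le_trans vQ)// lef_pV2 ?posrE// ler_nat.
- have [Ep|pE] := leqP E (p 0%N).
    have pm : {homo p : i j / (i <= j)%N} by apply: homo_leq => //; exact: leq_trans.
    left=> i iE; rewrite big1// => j _; rewrite /res ifF ?mulr0//.
    by apply/negbTE; rewrite negb_and -ltnNge (leq_trans iE)// (leq_trans Ep)// pm.
  (* Here n <= p 0 < E, so the n + 1 end points are at most E. An interval without end points meets
     at most one block, and there the factor 1/2 applies. *)
  right; exists (mkseq p n.+1) => [|v s t Es vK _ nL].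
    by rewrite size_mkseq (leq_trans (leq_ltn_trans np pE))// leq_addr.
  have cut j : (j <= n)%N -> ~~ (s <= p j < t)%N.
    by move=> jn; apply: nL; apply/mapP; exists j => //; rewrite mem_iota.
  have [ts|st] := leqP t s; first by rewrite pair_geq// normr0 invr_ge0.
  rewrite {1}/pair_; under eq_bigr do rewrite mulr_suml.
  rewrite exchange_big /=; under eq_bigr do under eq_bigr do rewrite -mulrA.
  under eq_bigr do rewrite -mulr_sumr.
  rewrite -mulr_sumr normrM gtr0_norm ?invr_gt0// ler_piMr ?invr_ge0//.
  apply: (@le_trans _ _ (\sum_(j < n) (p j <= s < p j.+1)%:R)); last first.
    rewrite -natr_sum (@le_trans _ _ ((s < p n)%N%:R))//; first by rewrite ler_nat block_count.
    by case: (_ < _)%N.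
  rewrite (le_trans (ler_norm_sum _ _ _))//; apply: ler_sum => j _.
  rewrite -/(pair_ (res (p j) (p j.+1) (h j)) v s t).
  have := cut j (ltnW (ltn_ord j)); have := cut j.+1 (ltn_ord j).
  have [spj|pjs] := leqP (p j) s; have [spj1|pj1s] := ltnP s (p j.+1) => /= c1 c2.
  + by apply: pairK_bd vK _; apply: K_res.
  + by rewrite pairC pair_res pair_geq ?normr0// geq_min (leq_trans pj1s) ?orbT ?leq_maxr//.
  + move: c2; rewrite (ltnW pjs) /= -leqNgt => tpj.
    by rewrite pairC pair_res pair_geq ?normr0// geq_min (leq_trans tpj) ?orbT ?leq_maxl.
  + move: c2; rewrite (ltnW pjs) /= -leqNgt => tpj.
    by rewrite pairC pair_res pair_geq ?normr0// geq_min (leq_trans tpj) ?orbT ?leq_maxl.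
Qed.

Variables (G : nat -> R) (M : R).
Hypothesis GM : bd (polar K) M G.

(** A one-sided bound suffices, as the conditions on [u] are unchanged under a change of sign. *)
Definition flat_bound (d : R) : Prop := exists n, exists2 tau : R, 0 < tau &
  forall u m, polar K u -> (n <= m)%N -> `|vsum x u n m| <= tau -> pair_ G u n m <= d.

Definition avg_coef m j : R := if j is 0%N then 1 else m%:R^-1.

Lemma flat_bound_step d : 0 < d -> flat_bound d -> flat_bound (9 / 10 * d).
Proof.
move=> d0 [n [tau tau0 Hd]]; apply: contrapT => nH.
(* 1/4 is the smallness asked by [K_cuts]. With tau/2, a block plus an average of blocks still has
   image of norm at most tau. *)
pose tau' : R := Num.min (tau / 2) 4^-1.
have tau'0 : 0 < tau' by rewrite lt_min divr_gt0//= invr_gt0.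
have [tau't tau'4] : tau' <= tau / 2 /\ tau' <= 4^-1.
  by split; rewrite ge_min lexx ?orbT.
have far k : exists mu : nat * (nat -> R), [/\ (k <= mu.1)%N, polar K mu.2,
    `|vsum x mu.2 k mu.1| <= tau' & 9 / 10 * d < pair_ G mu.2 k mu.1].
  apply: contrapT => h; apply: nH; exists k, tau' => // u m uK km uQ.
  by rewrite leNgt; apply/negP => lt; apply: h; exists (m, u).
have [f fP] := choice far.
pose s j := iter j (fun k => (f k).1) n.
pose u j := (f (s j)).2.
have sS j : (s j <= s j.+1)%N by have [] := fP (s j).
have uK j : polar K (u j) by have [] := fP (s j).
have uQ j : `|vsum x (u j) (s j) (s j.+1)| <= tau' by have [] := fP (s j).
have uG j : 9 / 10 * d < pair_ G (u j) (s j) (s j.+1) by have [] := fP (s j).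
have sm : {homo s : i j / (i <= j)%N} by apply: homo_leq => //; exact: leq_trans.
(* [E] is the end of the first block, so functionals vanishing before [E] do not see it. With this
   [m], the at most E + 2 blocks containing a cut weigh at most 1/10 in the average. *)
pose E := s 1%N; pose m := (10 * (E + 2))%N.
have m0 : (0 < m)%N by rewrite muln_gt0 addn_gt0 orbT.
have mR : 0 < m%:R :> R by rewrite ltr0n.
pose c := avg_coef m.
pose w k := \sum_(j < m.+1) c j * res (s j) (s j.+1) (u j) k.
have wE N g : (s m.+1 <= N)%N -> pair_ g w n N = \sum_(j < m.+1) c j * pair_ g (u j) (s j) (s j.+1).
  by move=> sN; apply: pair_blocks.
have avgE (F : nat -> R) : \sum_(j < m.+1) c j * F j = F 0%N + m%:R^-1 * \sum_(j < m) F j.+1.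
  rewrite big_ord_recl mul1r; congr (_ + _); rewrite mulr_sumr.
  by apply: eq_bigr => j _.
have avg_le (F : nat -> R) b : (forall j, F j <= b) -> m%:R^-1 * \sum_(j < m) F j.+1 <= b.
  move=> Fb; rewrite ler_pdivrMl// -[m in leRHS]card_ord mulr_natl -sumr_const.
  by apply: ler_sum.
have w_bd : bd K (16 / 10) w.
  move=> g N Kg; pose g' := res 0 N g.
  have Kg' : K g' by apply: K_res.
  pose N' := maxn N (s m.+1).
  have -> : pair_ g w 0 N = \sum_(j < m.+1) c j * pair_ g' (u j) (s j) (s j.+1).
    have sN' : (s m.+1 <= N')%N := leq_maxr _ _.
    rewrite -(wE _ _ sN').
    rewrite -(@pair_res_sub _ _ _ 0 N 0 N') ?leq_maxl// pair_resC -/g'.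
    rewrite (@pair_cat _ _ _ 0 n)//; last first.
      by rewrite (leq_trans _ (leq_maxr _ _))// (sm 0%N).
    rewrite [X in X + _](_ : _ = 0) ?add0r//.
    rewrite /pair_ big_nat_cond big1// => i /andP[/andP[_ iN] _].
    rewrite /w big1 ?mulr0// => j _; rewrite /res ifF ?mulr0//.
    by apply/negbTE; rewrite negb_and -ltnNge (leq_trans iN)// (sm 0%N).
  rewrite (avgE (fun j => pair_ g' (u j) (s j) (s j.+1))).
  rewrite (le_trans (ler_normD _ _))// normrM gtr0_norm ?invr_gt0//.
  pose F j := `|pair_ g' (u j) (s j) (s j.+1)|.
  have F1 j : F j <= 1 by apply: pairK_bd (uK j) _.
  have sumF : `|\sum_(j < m) pair_ g' (u j.+1) (s j.+1) (s j.+2)| <= \sum_(j < m) F j.+1.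
    exact: ler_norm_sum.
  have {sumF} sumF : m%:R^-1 * `|\sum_(j < m) pair_ g' (u j.+1) (s j.+1) (s j.+2)| <=
      m%:R^-1 * \sum_(j < m) F j.+1 by rewrite ler_wpM2l// invr_ge0 ltW.
  (* Either the first block contributes 0 and the average at most 1, or the total is at most 1 +
     (1/2 + 1/10) = 16/10. *)
  have [g0|[L sL gL]] := K_cuts E Kg'.
    have F0 : F 0%N = 0.
      rewrite /F /pair_ big_nat_cond big1 ?normr0// => i /andP[/andP[_ iE] _].
      by rewrite g0 ?mul0r.
    rewrite -/(F 0%N) F0; have := avg_le F 1 F1; lra.
  (* Each block counts 1/2, plus 1 for every cut inside it; by disjointness a cut is charged to one
     block only. *)
  have Fj j : F j.+1 <= 2^-1 + \sum_(q <- L) (s j.+1 <= q < s j.+2)%:R.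
    have [/hasP[q qL qs]|/hasPn none] := boolP (has (fun q => s j.+1 <= q < s j.+2)%N L).
      apply: le_trans (F1 _) _; rewrite (big_rem q qL) /= qs -[leLHS]add0r lerD ?invr_ge0//.
      by rewrite lerDl sumr_ge0.
    rewrite (@le_trans _ _ 2^-1)//; last by rewrite lerDl sumr_ge0.
    by apply: gL => //; [exact: sm|exact: le_trans (uQ _) tau'4].
  have : \sum_(j < m) F j.+1 <= m%:R / 2 + (E + 2)%:R.
    apply: (@le_trans _ _ (\sum_(j < m) (2^-1 + \sum_(q <- L) (s j.+1 <= q < s j.+2)%:R))).
      by apply: ler_sum => j _; exact: Fj.
    rewrite big_split /= sumr_const card_ord mulr_natl lerD//.
    rewrite exchange_big /=; apply: (@le_trans _ _ (\sum_(q <- L) 1)).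
      apply: ler_sum => q _; rewrite -natr_sum.
      apply: (@le_trans _ _ ((q < s m.+1)%N%:R)); last by case: (_ < _)%N.
      by rewrite ler_nat; apply: (@block_count (fun j => s j.+1)).
    by rewrite big_const_seq count_predT iter_addr_0 ler_nat.
  have := F1 0%N; rewrite -/(F 0%N) => F01.
  rewrite -(ler_pM2l (_ : 0 < m%:R^-1)) ?invr_gt0// mulrDr mulrA mulVf ?gt_eqF// mul1r.
  have -> : m%:R^-1 * (E + 2)%:R = 10^-1 :> R.
    rewrite /m natrM invfM mulrAC mulfK//.
  by move: sumF; lra.
have w'K : polar K (fun k => 10 / 16 * w k).
  by apply: bd_le (bdZ (10 / 16) w_bd); rewrite ger0_norm; lra.
have ns : (n <= s m.+1)%N by apply: (sm 0%N).
have w'Q : `|vsum x (fun k => 10 / 16 * w k) n (s m.+1)| <= tau.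
  rewrite vsumZ vsum_blocks// normrZ ger0_norm; last by lra.
  have : `|\sum_(j < m.+1) c j *: vsum x (u j) (s j) (s j.+1)| <=
         \sum_(j < m.+1) c j * `|vsum x (u j) (s j) (s j.+1)|.
    apply: le_trans (ler_norm_sum _ _ _) _; apply: ler_sum => j _; rewrite normrZ ger0_norm//.
    by rewrite /c; case: (j : nat) => [|i] //=; rewrite invr_ge0.
  rewrite (avgE (fun j => `|vsum x (u j) (s j) (s j.+1)|)).
  have := uQ 0%N; have := avg_le (fun j => `|vsum x (u j) (s j) (s j.+1)|) _ uQ.
  by move: tau't tau0; lra.
(* The normalized vector gives at most d, while its two parts give more than 10/16 * (9/10 + 9/10) d
   = 9/8 d. *)
have := Hd _ _ w'K ns w'Q; rewrite pairZr wE// (avgE (fun j => pair_ G (u j) (s j) (s j.+1))).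
have : 9 / 10 * d <= m%:R^-1 * \sum_(j < m) pair_ G (u j.+1) (s j.+1) (s j.+2).
  move: uG; set b := 9 / 10 * d => bG.
  rewrite ler_pdivlMl// -[m in leLHS]card_ord mulr_natl -sumr_const.
  by apply: ler_sum => j _; exact: ltW.
by have := uG 0%N; lra.
Qed.

(** Iterates the improvement from M + 1, a bound valid on the whole unit ball and positive even if M
    = 0. *)
Lemma flat_bound_small d : 0 < d -> flat_bound d.
Proof.
move=> d0; have M0 : 0 <= M := bd_ge0 (polar_unit x_le1) GM.
have M1 : 0 < M + 1 by rewrite ltr_wpDl.
have iterate k : flat_bound ((9 / 10) ^+ k * (M + 1)).
  elim: k => [|k IH].
    exists 0%N, 1 => // u m uK _ _; rewrite mul1r pairC.
    by have := GM m uK; rewrite pairC => /ler_normlW; lra.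
  by rewrite exprS -mulrA; apply: flat_bound_step => //; rewrite mulr_gt0// exprn_gt0.
have [k kd] : exists k, (9 / 10) ^+ k * (M + 1) <= d.
  have q : `|9 / 10 : R| < 1 by rewrite ger0_norm; lra.
  have /cvgrPdist_lt /(_ (d / (M + 1))) := cvg_expr q.
  rewrite divr_gt0// => /(_ isT) [k _ /(_ k (leqnn _))] /=.
  rewrite sub0r normrN ger0_norm ?exprn_ge0// => h; exists k.
  by rewrite -ler_pdivlMr// ltW.
have [n [tau tau0 H]] := iterate k.
by exists n, tau => // u m uK nm uQ; apply: le_trans (H _ _ uK nm uQ) kd.
Qed.

End FlatFunctionals.

Lemma eps_eq0 (R : realType) (C r : R) :
  (forall d : R, 0 < d -> `|r| <= C * d) -> r = 0.
Proof.
move=> h; apply/eqP; rewrite -normr_le0; apply/ler_addgt0Pr => e e0; rewrite add0r.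
have C0 : 0 < `|C| + 1 by rewrite ltr_wpDl.
apply: le_trans (h (e / (`|C| + 1)) _) _; first by rewrite divr_gt0.
rewrite mulrCA ler_piMr ?(ltW e0)// ler_pdivrMr// mul1r (le_trans (ler_norm _))//.
by rewrite lerDl.
Qed.

(** * Splitting a functional on W1 into a vanishing-tail part and a functional on X *)

Section Decomposition.
Variables (R : realType) (X : completeNormedModType R) (x : nat -> X).
Hypothesis x_le1 : forall i, `|x i| <= 1.
Hypothesis x_dense : forall y n (e : R), 0 < e ->
  exists2 i, (n <= i)%N & `| `|y| *: x i - y| < e.
Notation K := (K x).

Definition vanishing_tails (G : nat -> R) : Prop :=
  forall e : R, 0 < e -> exists n, bd (polar K) e (tail n G).

Definition single (c : R) i : nat -> R := fun j => c * unit_seq R i j.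

Lemma single_bd c i : bd K `|c| (single c i).
Proof. by move=> g n Kg; rewrite -[`|c|]mulr1; apply: (bdZ c (polar_unit x_le1 i)). Qed.

Lemma pair_single g c i s m : (s <= i < m)%N -> pair_ g (single c i) s m = c * g i.
Proof. by move=> im; rewrite pairZr pairC pair_unit_sub. Qed.

Lemma vsum_single c i s m : (s <= i < m)%N -> vsum x (single c i) s m = c *: x i.
Proof.
move=> /andP[si im]; rewrite vsumZ; congr (_ *: _).
rewrite /vsum (big_cat_nat si (ltnW im))/= big_nat_cond big1 ?add0r => [|j].
  rewrite big_ltn// /unit_seq eqxx scale1r big_nat_cond big1 ?addr0// => j.
  by case/andP => /andP[ij _] _; rewrite gtn_eqF ?scale0r.
by case/andP => /andP[_ ji] _; rewrite /unit_seq ltn_eqF ?scale0r.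
Qed.

Variables (G : nat -> R) (M : R).
Hypothesis GM : bd (polar K) M G.

(** (u - v)/(2C) is a far-out vector of the unit ball with small image; the one-sided bound is
    applied to it and to its negative. *)
Lemma close_vsum_close_pair d : 0 < d -> exists n, exists2 tau : R, 0 < tau &
  forall C u v s m, 0 < C -> (n <= s)%N -> (s <= m)%N -> bd K C u -> bd K C v ->
    `|vsum x u s m - vsum x v s m| <= C * tau ->
    `|pair_ G u s m - pair_ G v s m| <= C * d.
Proof.
move=> d0; have [n [tau tau0 H]] := flat_bound_small x_le1 GM (divr_gt0 d0 (ltr0n _ 2)).
exists n, (2 * tau); first by rewrite mulr_gt0.
move=> C u v s m C0 ns sm uC vC uv.
have C2 : 0 < 2 * C by rewrite mulr_gt0.
pose w k := (2 * C)^-1 * res s m (fun i => u i - v i) k.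
have wK : polar K w.
  have := bdZ (2 * C)^-1 (bdK_res s m (bdB uC vC)).
  by rewrite gtr0_norm ?invr_gt0// -mulr2n -[C *+ 2]mulr_natl mulVf// gt_eqF.
have wQ : `|vsum x w n m| <= tau.
  rewrite vsumZ vsum_res (maxn_idPl ns) minnn vsumB normrZ gtr0_norm ?invr_gt0//.
  by rewrite ler_pdivrMl// (le_trans uv)// mulrCA mulrA.
have wE : pair_ G w n m = (2 * C)^-1 * (pair_ G u s m - pair_ G v s m).
  by rewrite pairZr pair_res (maxn_idPl ns) minnn pairBr.
have nm := leq_trans ns sm.
have h1 := H _ _ wK nm wQ.
have h2 := H (fun i => - w i) _ (bdN wK) nm.
have wN : vsum x (fun i => - w i) n m = - vsum x w n m.
  by rewrite /vsum -sumrN; apply: eq_bigr => i _; rewrite scaleNr.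
rewrite wN normrN in h2; have := h2 wQ.
rewrite pairC pairN pairC; move: h1; rewrite wE -mulrN !ler_pdivrMl// => h1 h3.
by rewrite ler_norml; apply/andP; split; lra.
Qed.

(** Far out, [G] acts as [phi] composed with Q. The scale [C] makes the estimate homogeneous, so it
    applies to vectors of any norm. *)
Definition represents (phi : X -> R) : Prop :=
  forall d : R, 0 < d -> exists n, exists2 tau : R, 0 < tau &
  forall C u y s m, 0 < C -> (n <= s)%N -> (s <= m)%N -> bd K C u -> `|y| <= C ->
    `|vsum x u s m - y| <= C * tau -> `|pair_ G u s m - phi y| <= C * d.

(** [|y| e_i], with [|y| *: x i] close to y, is a one-coordinate lift of y. Two far-out lifts have
    nearly equal values under [G], so these values converge; the limit is [phi y], and any other
    lift is compared with a lift still further out. *)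
Lemma represents_exists : exists phi, represents phi.
Proof.
have H0 (k : nat) : 0 < k.+1%:R^-1 :> R by rewrite invr_gt0.
have [[y k]|f fP] := @choice _ _ (fun (yk : X * nat) i => (yk.2 <= i)%N /\
    `| `|yk.1| *: x i - yk.1| < yk.2.+1%:R^-1).
  by have [i ki iy] := x_dense y k (H0 k); exists i.
pose v y k := `|y| * G (f (y, k)).
have small (t : R) : 0 < t -> exists k0, forall k, (k0 <= k)%N -> k.+1%:R^-1 <= t.
  move=> t0; exists (Num.truncn t^-1) => k k0k.
  rewrite -[leRHS]invrK lef_pV2 ?posrE ?invr_gt0//.
  apply: le_trans (ltW (real_truncnS_gt (num_real _))) _.
  by rewrite ler_nat ltnS.
have limit y : exists l, forall e : R, 0 < e -> exists k0, forall k, (k0 <= k)%N -> `|v y k - l| <= e.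
  have C0 : 0 < `|y| + 1 by rewrite ltr_wpDl.
  have yC : `|y| <= `|y| + 1 by rewrite lerDl.
  have cau : cvg (v y @ \oo).
    apply: R_complete; apply: cauchy_exP => e e0.
    have [n [tau tau0 H]] := close_vsum_close_pair (divr_gt0 (divr_gt0 e0 (ltr0n _ 2)) C0).
    have [k0 k0P] := small ((`|y| + 1) * tau / 2) (divr_gt0 (mulr_gt0 C0 tau0) (ltr0n _ 2)).
    pose k1 := maxn n k0.
    exists (v y k1), k1 => // k /= k1k.
    rewrite -ball_normE /=.
    pose m := (maxn (f (y, k1)) (f (y, k))).+1.
    have fk j : (k1 <= j)%N -> (f (y, j) < m)%N -> (n <= f (y, j) < m)%N.
      by move=> k1j ->; rewrite (leq_trans _ (fP (y, j)).1)// (leq_trans (leq_maxl _ _) k1j).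
    have m1 := fk _ (leqnn _) (leq_maxl _ _ : (f (y, k1) < m)%N).
    have m2 := fk _ k1k (leq_maxr _ _ : (f (y, k) < m)%N).
    have := H (`|y| + 1) (single `|y| (f (y, k1))) (single `|y| (f (y, k))) n m C0 (leqnn _).
    rewrite !pair_single// !vsum_single//.
    have bdy i : bd K (`|y| + 1) (single `|y| i).
      by apply: bd_le (single_bd _ _); rewrite normr_id.
    have nm : (n <= m)%N by case/andP: m1 => a b; exact: leq_trans a (ltnW b).
    move=> /(_ nm (bdy _) (bdy _)) {}H.
    apply: le_lt_trans (H _) _; last by rewrite mulrC mulfVK ?gt_eqF//; lra.
    rewrite -(subrK y (`|y| *: x (f (y, k1)))) -addrA (le_trans (ler_normD _ _))//.
    have := k0P k1 (leq_maxr _ _); have := k0P k (leq_trans (leq_maxr _ _) k1k).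
    have := (fP (y, k1)).2; have := (fP (y, k)).2; rewrite /= -(normrN (_ - y)) opprB.
    move=> h1 h2 h3 h4; rewrite [leRHS]splitr lerD//; [exact: le_trans (ltW h2) h4|exact: le_trans (ltW h1) h3].
  exists (lim (v y @ \oo)) => e e0.
  have /cvgrPdist_le /(_ e e0) [k0 _ h] := cau.
  by exists k0 => k kk; rewrite distrC; exact: h.
have [phi phiP] := choice limit.
exists phi => d d0; have [n [tau tau0 H]] := close_vsum_close_pair d0.
exists n, (tau / 2); first by rewrite divr_gt0.
move=> C u y s m C0 ns sm uC yC uy; apply/ler_addgt0Pr => e e0.
have [k0 k0P] := phiP y e e0.
have [k1 k1P] := small (C * tau / 2) (divr_gt0 (mulr_gt0 C0 tau0) (ltr0n _ 2)).
(* k >= m places the comparison coordinate beyond [s, m). Truncated to that interval, [u] can be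
   compared with it on the longer interval [s, i + 1). *)
pose k := maxn m (maxn k0 k1).
have mk : (m <= k)%N := leq_maxl _ _.
have k0k : (k0 <= k)%N by rewrite leq_max leq_maxl orbT.
have k1k : (k1 <= k)%N by rewrite leq_max leq_maxr orbT.
pose i := f (y, k); have ki : (k <= i)%N := (fP (y, k)).1.
have si : (s <= i < i.+1)%N by rewrite ltnSn (leq_trans sm)// (leq_trans mk).
have mi : (m <= i.+1)%N by rewrite ltnW// ltnS (leq_trans mk).
have := H C (res s m u) (single `|y| i) s i.+1 C0 ns (leq_trans sm mi) (bdK_res _ _ uC).
rewrite pair_single// vsum_single// vsum_res pair_res maxnn (minn_idPl mi) => {}H.
have := H (bd_le _ (single_bd _ _)); rewrite normr_id => /(_ yC) {}H.
have Hk := k0P k k0k; rewrite /v -/i in Hk.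
rewrite -(subrK (`|y| * G i) (pair_ G u s m)) -addrA (le_trans (ler_normD _ _))//.
rewrite lerD//; apply: H.
rewrite -(subrK y (vsum x u s m)) -addrA (le_trans (ler_normD _ _))//.
have := k1P k k1k; have := (fP (y, k)).2; rewrite /= -/i -(normrN (_ - y)) opprB.
move: uy; rewrite mulrA => uy h1 h2; rewrite [leRHS]splitr lerD//; exact: le_trans (ltW h1) h2.
Qed.

Lemma represents_lin phi : represents phi -> lin phi.
Proof.
move=> phiP a y z; apply/eqP; rewrite -subr_eq0; apply/eqP.
(* Dominates y, z, a y + z and the lifts of all three; the summand 1 gives tau <= C tau. *)
pose C := `|a| * `|y| + `|z| + `|y| + 1.
have ay0 : 0 <= `|a| * `|y| by rewrite mulr_ge0.
have C0 : 0 < C by rewrite ltr_wpDl// !addr_ge0.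
apply: (@eps_eq0 _ (C * (`|a| + 2))) => d d0.
have [n [tau tau0 H]] := phiP d d0.
(* Errors eta at y and z add up to |a| eta + eta = tau at a y + z. *)
pose eta := tau / (`|a| + 1).
have a1 : 0 < `|a| + 1 by rewrite ltr_wpDl.
have eta0 : 0 < eta by rewrite divr_gt0.
have etaE : eta * (`|a| + 1) = tau by rewrite mulfVK// gt_eqF.
have etaC : eta * (`|a| + 1) <= C * tau.
  by rewrite etaE ler_peMl ?(ltW tau0)// lerDr !addr_ge0.
have eta1 : eta <= eta * (`|a| + 1) by rewrite ler_peMr ?(ltW eta0)// lerDr.
have [i ni iy] := x_dense y n eta0; have [j nj jz] := x_dense z n eta0.
pose m := (maxn i j).+1.
have im : (n <= i < m)%N by rewrite ni ltnS leq_maxl.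
have jm : (n <= j < m)%N by rewrite nj ltnS leq_maxr.
have nm : (n <= m)%N by rewrite (leq_trans ni)// ltnW// ltnS leq_maxl.
have := H C (single `|y| i) y n m C0 (leqnn _) nm.
rewrite pair_single// vsum_single// => H1.
have := H C (single `|z| j) z n m C0 (leqnn _) nm.
rewrite pair_single// vsum_single// => H2.
have := H C (fun k => a * single `|y| i k + single `|z| j k) (a *: y + z) n m C0 (leqnn _) nm.
rewrite pair_linr vsum_lin !pair_single// !vsum_single// => H3.
have nz0 := normr_ge0 z; have ny0 := normr_ge0 y.
have {}H1 : `| `|y| * G i - phi y| <= C * d.
  apply: H1; [|rewrite /C; lra|lra].
  by apply: bd_le (single_bd _ _); rewrite normr_id /C; lra.
have {}H2 : `| `|z| * G j - phi z| <= C * d.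
  apply: H2; [|rewrite /C; lra|lra].
  by apply: bd_le (single_bd _ _); rewrite normr_id /C; lra.
have {}H3 : `|a * (`|y| * G i) + `|z| * G j - phi (a *: y + z)| <= C * d.
  apply: H3.
  - by apply: bd_le (bd_lin a (single_bd _ _) (single_bd _ _)); rewrite !normr_id /C; lra.
  - by rewrite (le_trans (ler_normD _ _))// normrZ /C; lra.
  - rewrite opprD addrACA -scalerBr (le_trans (ler_normD _ _))// normrZ.
    have : `|a| * `| `|y| *: x i - y| <= `|a| * eta by rewrite ler_wpM2l// ltW.
    move: jz etaC; rewrite mulrDr mulr1; lra.
rewrite (_ : _ - _ = - (a * (`|y| * G i) + `|z| * G j - phi (a *: y + z)) +
   (a * (`|y| * G i - phi y) + (`|z| * G j - phi z))); last ring.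
rewrite (le_trans (ler_normD _ _))// normrN.
have := ler_normD (a * (`|y| * G i - phi y)) (`|z| * G j - phi z); rewrite normrM.
have := ler_wpM2l (normr_ge0 a) H1.
move: H2 H3; lra.
Qed.

Lemma represents_bounded phi y : represents phi -> `|phi y| <= M * `|y|.
Proof.
move=> phiP; apply/ler_addgt0Pr => e e0.
have C0 : 0 < `|y| + 1 by rewrite ltr_wpDl.
have [n [tau tau0 H]] := phiP _ (divr_gt0 e0 C0).
have [i ni iy] := x_dense y n tau0.
have := H (`|y| + 1) (single `|y| i) y n i.+1 C0 (leqnn _).
have hE : (`|y| + 1) * (e / (`|y| + 1)) = e by rewrite mulrC mulfVK ?gt_eqF.
rewrite pair_single ?vsum_single ?ni ?ltnSn// hE => h.
have {h} h : `| `|y| * G i - phi y| <= e.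
  apply: h; first by rewrite ltnW.
  - by apply: bd_le (single_bd _ _); rewrite normr_id lerDl.
  - by rewrite lerDl.
  - by rewrite (le_trans (ltW iy))// ler_peMl ?(ltW tau0)// lerDr.
have GiM : `|G i| <= M := bd_coord (polar_unit x_le1) i GM.
rewrite -(subKr (`|y| * G i) (phi y)) (le_trans (ler_normB _ _))// lerD//.
by rewrite normrM normr_id mulrC ler_wpM2r.
Qed.

(** Taking for y the exact image of [u], [represents] at scale 1 bounds [G] minus the pullback of
    [phi] uniformly on far-out vectors of the unit ball. *)
Lemma dual_decomposition : exists phi : X -> R, [/\ dual_el phi,
  forall y, `|phi y| <= M * `|y| & vanishing_tails (fun i => G i - phi (x i))].
Proof.
have [phi phiP] := represents_exists.
have phil := represents_lin phiP; have phib := fun y => represents_bounded y phiP.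
exists phi; split => //; first exact: bounded_dual phib.
move=> e e0; have [n [tau tau0 H]] := phiP e e0.
exists n; apply: bd_pairP (ltW e0) => u m uK nm.
rewrite pairBr pairC (_ : pair_ u (fun i => phi (x i)) n m = phi (vsum x u n m)); last first.
  by rewrite /vsum (lin_sum _ _ phil); apply: eq_bigr => i _; rewrite linZ.
have := H 1 u (vsum x u n m) n m ltr01 (leqnn _) nm uK (vsum_bd _ _ uK).
by rewrite !mul1r subrr normr0 => ->//; exact: ltW.
Qed.

End Decomposition.

(** * Lifting vectors of X to W1 with support far out *)

Section GreedyLift.
Variables (R : realType) (X : completeNormedModType R) (x : nat -> X).
Hypothesis x_le1 : forall i, `|x i| <= 1.
Hypothesis x_dense : forall y n (e : R), 0 < e ->
  exists2 i, (n <= i)%N & `| `|y| *: x i - y| < e.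
Notation K := (K x).

(** A term is used only if it at least halves the residual [r], and only from index [n] on. *)
Definition greedy_coef n i (r : X) : R :=
  if (n <= i)%N && (`| `|r| *: x i - r| <= `|r| / 2) then `|r| else 0.

Fixpoint residual n (y : X) i : X :=
  if i is j.+1 then residual n y j - greedy_coef n j (residual n y j) *: x j else y.

Definition greedy n y i : R := greedy_coef n i (residual n y i).

Lemma greedy_ge0 n y i : 0 <= greedy n y i.
Proof. by rewrite /greedy /greedy_coef; case: ifP. Qed.

Lemma vsum_greedy n y m : vsum x (greedy n y) 0 m = y - residual n y m.
Proof.
elim: m => [|m IH] /=; first by rewrite vsum_geq// subrr.
by rewrite (@vsum_cat _ _ _ _ _ m)// IH /vsum big_nat1 opprB [RHS]addrCA addrC.
Qed.

Lemma residual_step n y i :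
  `|residual n y i.+1| <= `|residual n y i| - greedy n y i / 2.
Proof.
rewrite /greedy /=; set r := residual n y i; rewrite /greedy_coef.
case: ifP => [/andP[_ h]|_]; last by rewrite mul0r scale0r !subr0.
by rewrite distrC; lra.
Qed.

Lemma residual_anti n y i j : (i <= j)%N -> `|residual n y j| <= `|residual n y i|.
Proof.
move=> /subnKC <-; elim: (j - i)%N => [|k IH]; first by rewrite addn0.
rewrite addnS (le_trans (residual_step _ _ _))//.
by have := greedy_ge0 n y (i + k); move: IH; lra.
Qed.

(** Let j be a later index at which [x j] approximates the direction of the residual r. Either some
    step before j was taken, which already halved r, or r is unchanged at j and the step is taken
    there. *)
Lemma residual_half n y i : (n <= i)%N -> exists j, `|residual n y j| <= `|residual n y i| / 2.
Proof.
move=> ni; set r := residual n y i.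
have [r0|r0] := eqVneq r 0; first by exists i; rewrite -/r r0 normr0 mul0r.
have r20 : 0 < `|r| / 2 by rewrite divr_gt0 ?normr_gt0.
have [j ij hj] := x_dense r i r20.
have alt k : residual n y (i + k) = r \/ `|residual n y (i + k)| <= `|r| / 2.
  elim: k => [|k [IH|IH]]; first by left; rewrite addn0.
    rewrite addnS /= IH /greedy_coef.
    case: ifP => [/andP[_ h]|_]; last by left; rewrite scale0r subr0.
    by right; rewrite distrC.
  by right; rewrite (le_trans _ IH)// residual_anti// leq_add2l.
exists j.+1; case: (alt (j - i)%N); rewrite subnKC// => rj.
  by rewrite /= rj /greedy_coef (leq_trans ni ij) ltW//= distrC ltW.
by rewrite (le_trans _ rj)// residual_anti.
Qed.

Lemma residual_small n y (e : R) : 0 < e -> exists m, forall j, (m <= j)%N -> `|residual n y j| <= e.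
Proof.
move=> e0.
have iterate k : exists2 m, (n <= m)%N & `|residual n y m| <= 2^-1 ^+ k * `|y|.
  elim: k => [|k [m nm mk]].
    by exists n => //; rewrite expr0 mul1r (@residual_anti n y 0).
  have [j hj] := residual_half y nm; exists (maxn n j); first exact: leq_maxl.
  rewrite (le_trans (residual_anti _ _ (leq_maxr n j)))// (le_trans hj)//.
  by rewrite exprS -mulrA mulrC ler_wpM2l.
have [k kd] : exists k, 2^-1 ^+ k * `|y| <= e.
  have q : `|2^-1 : R| < 1 by rewrite ger0_norm; lra.
  have y1 : 0 < `|y| + 1 by rewrite ltr_wpDl.
  have /cvgrPdist_lt /(_ (e / (`|y| + 1))) := cvg_expr q.
  rewrite divr_gt0// => /(_ isT) [k _ /(_ k (leqnn _))] /=.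
  rewrite sub0r normrN ger0_norm ?exprn_ge0// => h; exists k.
  rewrite (@le_trans _ _ (2^-1 ^+ k * (`|y| + 1)))//.
    by rewrite ler_wpM2l ?exprn_ge0// lerDl.
  by rewrite -ler_pdivlMr// ltW.
have [m _ hm] := iterate k; exists m => j mj.
by rewrite (le_trans (residual_anti _ _ mj))// (le_trans hm).
Qed.

(** Each step lowers the norm of the residual by at least half the coefficient, so the coefficients
    sum to at most 2 |y|. Their sum bounds the K-norm, functionals of [K] having coordinates of
    modulus at most 1. *)
Lemma greedy_lift n y : exists c : nat -> R, [/\ bd K (2 * `|y|) c,
  forall i, (i < n)%N -> c i = 0 & vsum x c 0 m @[m --> \oo] --> y].
Proof.
exists (greedy n y); split.
- have sumc m : \sum_(0 <= i < m) greedy n y i <= 2 * (`|y| - `|residual n y m|).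
    elim: m => [|m IH]; first by rewrite big_nil subrr mulr0.
    by rewrite big_nat_recr//=; have := residual_step n y m; move: IH => /=; lra.
  move=> g m Kg; rewrite (le_trans (ler_norm_sum _ _ _))//.
  apply: (@le_trans _ _ (\sum_(0 <= i < m) greedy n y i)).
    apply: ler_sum => i _; rewrite normrM (ger0_norm (greedy_ge0 _ _ _)).
    by rewrite ler_piMl ?greedy_ge0// (K_coord_le1 x_le1 i Kg).
  by rewrite (le_trans (sumc m))// ler_pM2l// lerBlDr lerDl.
- by move=> i iN; rewrite /greedy /greedy_coef leqNgt iN.
- apply/cvgrPdist_le => e e0; have [m hm] := residual_small n y e0.
  by exists m => // j /= mj; rewrite vsum_greedy opprB addrCA subrr addr0 hm.
Qed.

End GreedyLift.

(** * The duality pairing between W1 and its dual *)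

Section Action.
Variables (R : realType) (X : completeNormedModType R) (x : nat -> X).
Hypothesis x_le1 : forall i, `|x i| <= 1.
Notation K := (K x).

Lemma tail_pair_small N a (e : R) : bd K N a -> 0 < e -> exists n, forall M G s t,
  bd (polar K) M G -> (n <= s)%N -> `|pair_ G a s t| <= M * e.
Proof.
move=> aN e0; have [n hn] := boundedly_complete aN e0; exists n => M G s t GM ns.
rewrite (_ : pair_ G a s t = pair_ G (tail n a) s t); first exact: (dualK_pair x_le1).
apply: eq_big_nat => i /andP[si _]; by rewrite /tail (leq_trans ns si).
Qed.

(** The value of the functional [G] of W1^* at [a]. The limit exists by [act_cvg], because the tails
    of [a] tend to 0 in K-norm. *)
Definition act (G a : nat -> R) : R := lim (pair_ G a 0 n @[n --> \oo]).

Lemma act_cvg M G N a : bd (polar K) M G -> bd K N a ->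
  pair_ G a 0 n @[n --> \oo] --> act G a.
Proof.
move=> GM aN; apply: R_complete; apply: cauchy_exP => e e0.
have M0 : 0 <= M := bd_ge0 (polar_unit x_le1) GM.
have M1 : 0 < M + 1 by rewrite ltr_wpDl.
have [n hn] := tail_pair_small aN (divr_gt0 e0 M1).
exists (pair_ G a 0 n), n => // m /= nm; rewrite -ball_normE /=.
rewrite (pair_cat G a (leq0n n) nm) opprD addrA subrr add0r normrN.
apply: le_lt_trans (hn _ _ n m GM (leqnn _)) _.
by rewrite mulrA ltr_pdivrMr// mulrC ltr_pM2l// ltrDl.
Qed.

Lemma act_eq G a l : pair_ G a 0 n @[n --> \oo] --> l -> act G a = l.
Proof. exact: cvg_lim. Qed.

Lemma act_bound M G N a : bd (polar K) M G -> bd K N a -> `|act G a| <= M * N.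
Proof.
move=> GM aN; have h : `|pair_ G a 0 n| @[n --> \oo] --> `|act G a|.
  by apply: cvg_norm; exact: act_cvg GM aN.
rewrite -(cvg_lim (@Rhausdorff R) h); apply: limr_le.
  by apply/cvg_ex; eexists; exact: h.
by near=> n; exact: (dualK_pair x_le1).
Unshelve. all: by end_near. Qed.

Lemma act_lin_r M G N N' c a b : bd (polar K) M G -> bd K N a -> bd K N' b ->
  act G (fun i => c * a i + b i) = c * act G a + act G b.
Proof.
move=> GM aN bN; apply: act_eq.
under eq_fun do rewrite pair_linr.
by apply: cvgD; [apply: cvgMr; exact: act_cvg GM aN|exact: act_cvg GM bN].
Qed.

Lemma act_lin_l M M' G H N c a : bd (polar K) M G -> bd (polar K) M' H -> bd K N a ->
  act (fun i => c * G i + H i) a = c * act G a + act H a.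
Proof.
move=> GM HM aN; apply: act_eq.
under eq_fun do rewrite pair_lin.
by apply: cvgD; [apply: cvgMr; exact: act_cvg GM aN|exact: act_cvg HM aN].
Qed.

Lemma act_finite G a n : (forall i, (n <= i)%N -> a i = 0) -> act G a = pair_ G a 0 n.
Proof.
move=> a0; apply: act_eq; apply/cvgrPdist_lt => e e0; exists n => // m /= nm.
rewrite (pair_cat G a (leq0n n) nm) opprD addrA subrr add0r normrN.
rewrite /pair_ big_nat_cond big1 ?normr0// => i /andP[/andP[ni _] _].
by rewrite a0// mulr0.
Qed.

Lemma pair_dual (phi : X -> R) a s t : lin phi ->
  pair_ (fun i => phi (x i)) a s t = phi (vsum x a s t).
Proof.
move=> phil; rewrite /vsum (lin_sum _ _ phil); apply: eq_bigr => i _.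
by rewrite linZ// mulrC.
Qed.

(** [phi (x i)] is the coefficient sequence of the pullback of [phi] by the contraction Q. *)
Lemma dual_bd (phi : X -> R) M : lin phi -> (forall y, `|phi y| <= M * `|y|) -> 0 <= M ->
  bd (polar K) M (fun i => phi (x i)).
Proof.
move=> phil phiM M0 u n uK; rewrite pairC pair_dual// (le_trans (phiM _))//.
by rewrite ler_piMr// vsum_bd.
Qed.

Lemma act_dual (phi : X -> R) a y : dual_el phi -> vsum x a 0 n @[n --> \oo] --> y ->
  act (fun i => phi (x i)) a = phi y.
Proof.
move=> [phil phic] ay; apply: act_eq.
under eq_fun do rewrite (pair_dual _ _ _ phil).
apply: (@cvg_comp _ _ _ (vsum x a 0) phi _ _ _ ay); exact: phic.
Qed.

End Action.

(** * The space Z: basis, separability and the asymptotic-c_0 game *)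

Section Predual.
Variables (R : realType) (X : completeNormedModType R) (x : nat -> X).
Hypothesis x_le1 : forall i, `|x i| <= 1.
Notation K := (K x).

Lemma polarK_tail M G s : bd (polar K) M G -> bd (polar K) M (tail s G).
Proof. by apply: bd_tail => h ? ?; exact: polarK_res. Qed.

Lemma tail_tail (G : nat -> R) s t : tail s (tail t G) = tail (maxn s t) G.
Proof. by apply/funext => i; rewrite /tail geq_max; case: (s <= i)%N. Qed.

Lemma bd_tail_mono M G s t : (s <= t)%N -> bd (polar K) M (tail s G) -> bd (polar K) M (tail t G).
Proof. by move=> st /(@polarK_tail _ _ t); rewrite tail_tail (maxn_idPl st). Qed.

Lemma vanishing_tails0 : vanishing_tails x (fun=> 0).
Proof.
move=> e e0; exists 0%N; rewrite (_ : tail 0 _ = fun=> 0) ?funeqE//.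
exact/bd0/ltW.
Qed.

Lemma vanishing_tails_lin (c : R) a b : vanishing_tails x a -> vanishing_tails x b ->
  vanishing_tails x (fun i => c * a i + b i).
Proof.
move=> ha hb e e0; have c0 : 0 < `|c| + 1 by rewrite ltr_wpDl.
have d0 : 0 < e / (`|c| + 1) by rewrite divr_gt0.
have [n hn] := ha _ d0; have [m hm] := hb _ d0.
exists (maxn n m).
have {}hn := bd_tail_mono (leq_maxl n m) hn; have {}hm := bd_tail_mono (leq_maxr n m) hm.
rewrite (_ : tail _ _ = fun i => c * tail (maxn n m) a i + tail (maxn n m) b i).
  apply: bd_le (bd_lin c hn hm); rewrite -[X in _ + X]mul1r -mulrDl.
  by rewrite mulrC mulfVK// gt_eqF.
by apply/funext => i; rewrite /tail; case: ifP; rewrite ?mulr0 ?addr0.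
Qed.

Lemma vanishing_tails_closed M a : bd (polar K) M a ->
  (forall e : R, 0 < e -> exists2 b, vanishing_tails x b & bd (polar K) e (fun i => a i - b i)) ->
  vanishing_tails x a.
Proof.
move=> _ h e e0; have e20 : 0 < e / 2 by rewrite divr_gt0.
have [b hb ab] := h _ e20; have [n hn] := hb _ e20; exists n.
rewrite (_ : tail n a = fun i => tail n (fun i => a i - b i) i + tail n b i).
  by rewrite [e]splitr; apply: bdD => //; exact: polarK_tail.
by apply/funext => i; rewrite /tail; case: ifP; rewrite ?subrK ?addr0.
Qed.

Definition predual_space : seqspace R :=
  SeqSpace (polar_unit x_le1) vanishing_tails0 vanishing_tails_lin vanishing_tails_closed.
Notation Z := (seqT predual_space).

Lemma vanishing_unit k : vanishing_tails x (unit_seq R k).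
Proof.
move=> e e0; exists k.+1; rewrite (_ : tail _ _ = fun=> 0); first exact/bd0/ltW.
by apply/funext => i; rewrite /tail /unit_seq; case: ifP => // /gtn_eqF ->.
Qed.

Lemma dual_unit_bd k : bd (polar K) 1 (unit_seq R k).
Proof.
move=> u n uK; have := uK _ n (K_unit x k).
by rewrite pairC.
Qed.

Lemma unit_basis : {E : nat -> Z & forall k, E k = unit_seq R k :> (nat -> R)}.
Proof.
apply: (@choice _ _ (fun k (e : Z) => e = unit_seq R k :> (nat -> R))) => k.
exact: (@seqT_exists R predual_space 1 _ (vanishing_unit k) (dual_unit_bd k)).
Qed.

Definition basis k : Z := projT1 unit_basis k.
Lemma basisE k : basis k = unit_seq R k :> (nat -> R).
Proof. exact: (projT2 unit_basis). Qed.

Lemma basis_sum (a : nat -> R) n : \sum_(i < n) a i *: basis i = res 0 n a :> (nat -> R).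
Proof.
apply/funext => k; rewrite seqT_sum /res /=.
rewrite (eq_bigr (fun i : 'I_n => a i * unit_seq R i k)); last first.
  by move=> i _; rewrite -basisE.
rewrite -(big_mkord xpredT (fun i => a i * unit_seq R i k)).
rewrite (eq_bigr (fun i => a i * unit_seq R k i)) => [|i _]; last first.
  by rewrite /unit_seq eq_sym.
rewrite -/(pair_ a (unit_seq R k) 0 n) pairC; have [kn|nk] := ltnP k n.
  by rewrite pair_unit.
rewrite /pair_ big_nat_cond big1// => i /andP[/andP[_ ik] _].
by rewrite /unit_seq ltn_eqF ?mul0r// (leq_trans ik).
Qed.

Lemma basis_le1 k : `|basis k| <= 1.
Proof. by apply: norm_le_bd; rewrite basisE; exact: dual_unit_bd. Qed.

Lemma trunc_tail (z : Z) n : z - \sum_(i < n) z i *: basis i = tail n z :> (nat -> R).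
Proof.
apply/funext => k; rewrite seqTB basis_sum /res /tail /=.
by case: ltnP => _; rewrite ?subrr ?subr0.
Qed.

Lemma vanishing_norm (z : Z) (e : R) : 0 < e -> exists n, bd (polar K) e (tail n z).
Proof. by move=> e0; exact: (seq_val_member z). Qed.

Lemma predual_separable : separable (seqspace_banach predual_space).
Proof.
apply: (@separable_span _ _ basis) => [|z e e0]; first exact: basis_le1.
have [n hn] := vanishing_norm z (divr_gt0 e0 (ltr0n _ 2)).
exists z, n; apply: (@le_lt_trans _ _ (e / 2)); last by lra.
by apply: norm_le_bd; rewrite trunc_tail.
Qed.

(** Otherwise [|pair_ G v s t| - eta] would bound the K-norm of [v] cut to [s, t), hence also the
    pairing with [G] itself. *)
Lemma bipolar_pair (G v : nat -> R) s t (eta : R) : bd (polar K) 1 G -> 0 < eta ->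
  exists2 g, K g & `|pair_ G v s t| <= `|pair_ g v s t| + eta.
Proof.
move=> G1 eta0; apply: contrapT => h.
have lt g : K g -> `|pair_ g v s t| < `|pair_ G v s t| - eta.
  by move=> Kg; rewrite ltNge; apply/negP => le; apply: h; exists g => //; lra.
have b0 : 0 <= `|pair_ G v s t| - eta by apply: le_trans (ltW (lt _ (K_unit x 0))).
have vb : bd K (`|pair_ G v s t| - eta) (res s t v).
  move=> g n Kg; have := lt _ (K_res 0 n Kg).
  by rewrite pairC pair_res pair_res pairC maxnC minnC => /ltW.
have := dualK_pair x_le1 s t G1 vb.
by rewrite pair_res_sub// mul1r; lra.
Qed.

(** Invariant for a game of [k] rounds: the i-th vector vanishes before [p i] and is negligible from
    [p i.+1] on. All blocks start at or after [k], so [step_bd] applies to them at the end. *)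
Lemma predual_game k n (xs : seq Z) (p : nat -> nat) :
  (forall j, (p j <= p j.+1)%N) -> (k <= p 0)%N -> (size xs + n)%N = k ->
  (forall i, (i < size xs)%N -> [/\ `|xs`_i| <= 1,
     forall j, (j < p i)%N -> xs`_i j = 0 & bd (polar K) k.+1%:R^-1 (tail (p i.+1) xs`_i)]) ->
  @asym_c0_game R (seqspace_banach predual_space) 4 n xs.
Proof.
elim: n xs p => [|n IH] xs p pS kp sz inv.
  rewrite addn0 in sz => a sa; set m := \big[Num.max/0]_(_ < _) _.
  have am (i : 'I_(size xs)) : `|a`_i| <= m by exact: le_bigmax.
  have m0 : 0 <= m by exact: bigmax_ge_id.
  apply: norm_le_bd => u N uK.
  pose v := res 0 N u; have vK : polar K v := polarK_res 0 N uK.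
  pose N' := maxn N (p k).
  have pm : {homo p : i j / (i <= j)%N} by apply: homo_leq => //; exact: leq_trans.
  have -> : pair_ u (\sum_(i < size xs) a`_i *: xs`_i : Z) 0 N =
      \sum_(i < size xs) a`_i * pair_ v xs`_i 0 N'.
    rewrite -(@pair_res_sub _ u _ 0 N 0 N') ?leq_maxl// pair_resC -/v.
    under [RHS]eq_bigr do rewrite /pair_ mulr_sumr.
    rewrite exchange_big /=; apply: eq_bigr => j _.
    rewrite seqT_sum mulr_sumr; apply: eq_bigr => i _.
    by rewrite seqTZ mulrCA.
  have d0 : 0 < k.+1%:R^-1 :> R by rewrite invr_gt0.
  have [i|g gP] := @choice _ _ (fun i (g : nat -> R) => K g /\ ((i < size xs)%N ->
      `|pair_ v xs`_i (p i) (p i.+1)| <= `|pair_ g v (p i) (p i.+1)| + k.+1%:R^-1)).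
    have [ik|ki] := ltnP i (size xs); last by exists (unit_seq R 0); split => //; exact: K_unit.
    have [i1 _ _] := inv i ik.
    have x1 : bd (polar K) 1 xs`_i by apply: bd_le i1 (bd_norm _).
    by have [g Kg hg] := bipolar_pair v (p i) (p i.+1) x1 d0; exists g; rewrite // pairC.
  have sumg := step_bd kp pS (fun j => (gP j).1) vK.
  have kd : k%:R * k.+1%:R^-1 <= 1 :> R by rewrite ler_pdivrMr// mul1r ler_nat.
  (* The two errors 1/(k+1) come from replacing [xs_i] by an element of [K] on its block and from
     its tail. The blocks sum to at most 2 and each kind of error to at most 1, whence the constant
     4. *)
  apply: (@le_trans _ _ (\sum_(i < size xs) m *
      (`|pair_ (g i) v (p i) (p i.+1)| + k.+1%:R^-1 + k.+1%:R^-1))).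
    rewrite (le_trans (ler_norm_sum _ _ _))//; apply: ler_sum => i _.
    rewrite normrM; apply: ler_pM => //.
    have [_ lo hi] := inv i (ltn_ord i).
    have piN : (p i.+1 <= N')%N by rewrite leq_max pm ?orbT// -sz ltn_ord.
    rewrite (@pair_cat _ _ _ _ (p i.+1))// (le_trans (ler_normD _ _))// lerD//.
      rewrite (@pair_cat _ _ _ _ (p i))// [X in X + _](_ : _ = 0) ?add0r ?(gP i).2//.
      by rewrite /pair_ big_nat_cond big1// => j /andP[/andP[_ ji] _]; rewrite lo ?mulr0.
    by have := hi v N' vK; rewrite pair_tail.
  rewrite -mulr_sumr mulrC ler_wpM2r// big_split big_split /= !sumr_const card_ord sz.
  rewrite -[k.+1%:R^-1 *+ k]mulr_natl.
  by move: kd sumg; rewrite mulr1; set r := _ / _; set s := (\sum_(_ < _) _); clear; lra.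
pose q := p (size xs).
(* The subspace forces the next vector to start where the previous ones have become negligible. *)
exists [set z : Z | forall j, (j < q)%N -> z j = 0]; split.
  split; [split => // [c y z hy hz j jq]|split].
  - by rewrite seqTD seqTZ hy// hz// mulr0 addr0.
  - move=> z clz j jq; apply/eqP; rewrite -normr_le0; apply/ler_addgt0Pr => e e0.
    rewrite add0r; have [w [wY]] := clz _ (nbhsx_ballx z e e0).
    rewrite -ball_normE /= => /ltW zw; apply: le_trans zw.
    by have := coord_le_norm (z - w) j; rewrite seqTB wY// subr0.
  - exists (mkseq basis q) => z; exists (z - \sum_(i < q) z i *: basis i).
      by move=> j jq; rewrite trunc_tail /tail leqNgt jq.
    exists (fun i => z i); rewrite size_mkseq.
    rewrite [X in _ + X](_ : _ = \sum_(i < q) z i *: basis i) ?subrK//.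
    by apply: eq_bigr => i _; rewrite nth_mkseq.
move=> y yY y1; have d0 : 0 < k.+1%:R^-1 :> R by rewrite invr_gt0.
have [n0 hn0] := vanishing_norm y d0.
(* Earlier cuts are kept; the new one lies where the tail of [y] is below 1/(k+1). *)
pose p' j := if (j <= size xs)%N then p j else maxn q n0.
apply: (IH _ p').
- move=> j; rewrite /p'; have [js|sj] := ltnP j (size xs); first by rewrite (ltnW js).
  by case: ifP => // js; rewrite (eqP (_ : j == size xs)) ?leq_maxl// eqn_leq js.
- by rewrite /p' leq0n.
- by rewrite size_rcons -sz addSnnS.
- move=> i; rewrite size_rcons ltnS nth_rcons leq_eqVlt => /orP[/eqP ->|ik].
    rewrite ltnn eqxx /p' leqnn ltnn; split; [by rewrite y1|exact: yY|].
    exact: bd_tail_mono (leq_maxr _ _) hn0.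
  by rewrite ik /p' ik (ltnW ik); exact: inv.
Qed.

Lemma predual_asymptotic_c0 : asymptotic_c0 (seqspace_banach predual_space).
Proof.
exists 4; split=> [|k]; first by rewrite ler1n.
by apply: (@predual_game k k [::] (fun=> k)).
Qed.

End Predual.

(** * Z as the dual of the kernel of Q *)

Section KernelSpace.
Variables (R : realType) (X : completeNormedModType R) (x : nat -> X).
Hypothesis x_le1 : forall i, `|x i| <= 1.
Hypothesis x_dense : forall y n (e : R), 0 < e ->
  exists2 i, (n <= i)%N & `| `|y| *: x i - y| < e.
Notation K := (K x).
Notation Z := (seqT (predual_space x_le1)).

Definition in_kernel (a : nat -> R) : Prop := vsum x a 0 n @[n --> \oo] --> (0 : X).

Lemma in_kernel0 : in_kernel (fun=> 0).
Proof.
apply/cvgrPdist_lt => e e0; exists 0%N => // n _ /=.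
by rewrite /vsum big1 ?subrr ?normr0// => i _; rewrite scale0r.
Qed.

Lemma in_kernel_lin (c : R) a b : in_kernel a -> in_kernel b ->
  in_kernel (fun i => c * a i + b i).
Proof.
move=> ha hb; rewrite /in_kernel; under eq_fun do rewrite vsum_lin.
rewrite -[0]addr0 -[X in X + _](scaler0 _ c).
by apply: cvgD => //; apply: cvgZr.
Qed.

Lemma in_kernel_closed M a : bd K M a ->
  (forall e : R, 0 < e -> exists2 b, in_kernel b & bd K e (fun i => a i - b i)) ->
  in_kernel a.
Proof.
move=> _ h; apply/cvgrPdist_le => e e0; have e20 : 0 < e / 2 by rewrite divr_gt0.
have [b /cvgrPdist_le /(_ _ e20) [n _ hn] ab] := h _ e20; exists n => // m /= nm.
have := hn m nm; rewrite /= !sub0r !normrN => bm.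
rewrite -[vsum x a 0 m](subrK (vsum x b 0 m)) -vsumB (le_trans (ler_normD _ _))//.
by rewrite [e]splitr lerD// vsum_bd.
Qed.

Definition kernel_space : seqspace R :=
  SeqSpace (K_unit x) in_kernel0 in_kernel_lin in_kernel_closed.
Notation W := (seqT kernel_space).

Lemma in_kernel_sub a b (y : X) : vsum x a 0 n @[n --> \oo] --> y -> vsum x b 0 n @[n --> \oo] --> y ->
  in_kernel (fun i => a i - b i).
Proof.
move=> ha hb; rewrite /in_kernel; under eq_fun do rewrite vsumB.
by rewrite -(subrr y); apply: cvgB.
Qed.

Definition kernel_action (z : Z) (w : W) : R := act z w.

Lemma norm_bdZ (z : Z) : bd (polar K) `|z| z. Proof. exact: (bd_norm z). Qed.
Lemma norm_bdW (w : W) : bd K `|w| w. Proof. exact: (bd_norm w). Qed.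

Lemma kernel_action_dual z : dual_el (kernel_action z : seqspace_banach kernel_space -> R).
Proof.
apply: (@bounded_dual _ (seqspace_banach kernel_space) _ `|z|) => [c v w|w].
  exact: (act_lin_r x_le1 c (norm_bdZ z) (norm_bdW v) (norm_bdW w)).
exact: (act_bound x_le1 (norm_bdZ z) (norm_bdW w)).
Qed.

(** Extend [f] from the kernel to W1 by Hahn-Banach and decompose the extension. Its part coming
    from X vanishes on the kernel, so the vanishing-tail part, an element of Z, already induces
    [f]. *)
Lemma kernel_action_onto (f : seqspace_banach kernel_space -> R) : dual_el f ->
  exists z, kernel_action z = f.
Proof.
move=> fd; have fl := dual_lin fd; have f0 := dnorm_ge0 fd.
pose D := [set a : nat -> R | exists M, bd K M a].
pose p (a : nat -> R) := dnorm f * nrm K a.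
have bdn a : D a -> bd K (nrm K a) a by move=> [M aM]; exact: (bd_nrm aM).
have Dlin (c : R) (a b : nat -> R) : D a -> D b -> D (c *: a + b).
  by move=> [M aM] [N bN]; eexists; exact: (bd_lin c aM bN).
have pD a b : D a -> D b -> p (a + b) <= p a + p b.
  move=> Da Db; rewrite -mulrDr ler_wpM2l//; apply: (nrm_le (K_unit x)).
  exact: bdD (bdn _ Da) (bdn _ Db).
have pZle (c : R) a : 0 < c -> D a -> nrm K (c *: a) <= c * nrm K a.
  move=> c0 Da; apply: (nrm_le (K_unit x)); rewrite -[X in X * _](gtr0_norm c0).
  exact: bdZ (bdn _ Da).
have pZ (c : R) a : 0 < c -> D a -> p (c *: a) = c * p a.
  move=> c0 Da; rewrite /p mulrCA; congr (_ * _); apply/eqP; rewrite eq_le pZle//=.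
  rewrite -ler_pdivlMl// -{1}[a](scale1r a) -(mulVf (lt0r_neq0 c0)) -scalerA.
  apply: pZle; rewrite ?invr_gt0//.
  have [M aM] := Da; exists (`|c| * M); exact: (bdZ c aM).
pose Y := [set a : nat -> R | in_kernel a /\ D a].
(* The default 0 is harmless: only values on [Y] are used. *)
pose toW (a : nat -> R) : W := insubd 0 a.
have toWE a : Y a -> toW a = a :> (nat -> R).
  by move=> [ka Da]; rewrite /toW val_insubd ifT//; apply/asboolP.
have toWK (w : W) : toW w = w by apply: val_inj; rewrite /= toWE//; split;
  [exact: (seq_val_member w)|exists `|w|; exact: norm_bdW].
have [||||g [gY gl gp]] := @hahn_banach R _ D p Dlin pD pZ Y (fun a => f (toW a)).
- by split; [exact: in_kernel0|exists 0; exact: bd0].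
- by move=> a [].
- move=> c a b Ya Yb.
  have Yab : Y (c *: a + b) by split; [exact: in_kernel_lin Ya.1 Yb.1|exact: Dlin Ya.2 Yb.2].
  split => //; rewrite -fl; congr f; apply: val_inj.
  by rewrite /= (toWE _ Yab) (toWE _ Ya) (toWE _ Yb).
- move=> a Ya; rewrite (le_trans (ler_norm _))// (le_trans (dual_bound _ fd))//.
  rewrite ler_wpM2l//; apply: norm_le_bd; rewrite (toWE _ Ya); exact: bdn Ya.2.
have D0 : D 0 by exists 0; exact: bd0.
have g0 : g 0 = 0 by have := gl (-1) 0 0 D0 D0; rewrite scaler0 addr0; lra.
have gN a : D a -> g (- a) = - g a.
  by move=> Da; have := gl (-1) a 0 Da D0; rewrite scaleN1r addr0 g0; lra.
have gabs a M : bd K M a -> `|g a| <= dnorm f * M.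
  move=> aM; have Da : D a by exists M.
  have DNa : D (- a) by exists M; exact: bdN aM.
  have le b : D b -> bd K M b -> g b <= dnorm f * M.
    move=> Db bM; rewrite (le_trans (gp _ Db))// ler_wpM2l//.
    exact: (nrm_le (K_unit x)).
  rewrite ler_norml lerNl -gN// le//; last exact: bdN aM.
  exact: le.
have gB a b : D a -> D b -> g (a - b) = g a - g b.
  by move=> Da Db; rewrite addrC -scaleN1r gl// mulN1r addrC.
pose G i := g (unit_seq R i).
have Dunit i : D (unit_seq R i) by exists 1; exact: polar_unit.
have Dres M a n : bd K M a -> D (res 0 n a) by move=> aM; exists M; exact: bdK_res.
have gfin a n : g (res 0 n a) = pair_ G a 0 n.
  have Dfin m : D (res 0 m a).
    elim: m => [|m [M hM]]; first by exists 0; rewrite (_ : res 0 0 a = fun=> 0); [exact: bd0|apply/funext].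
    exists (`|a m| * 1 + M).
    rewrite (_ : res 0 m.+1 a = fun i => a m * unit_seq R m i + res 0 m a i).
      exact: (bd_lin (a m) (polar_unit x_le1 m) hM).
    apply/funext => i; rewrite /res /unit_seq /= ltnS leq_eqVlt; case: eqVneq => [->|_] /=.
      by rewrite ltnn mulr1 addr0.
    by rewrite mulr0 add0r.
  elim: n => [|n IH].
    rewrite (_ : res 0 0 a = 0); last by apply/funext.
    by rewrite g0 pair_geq.
  rewrite (_ : res 0 n.+1 a = a n *: unit_seq R n + res 0 n a).
    by rewrite gl// IH (@pair_cat _ G a 0 n n.+1)// [X in _ = _ + X]/pair_ big_nat1 addrC mulrC.
  apply/funext => i; rewrite /res /= ltnS leq_eqVlt !fctE /unit_seq /=.
  case: eqVneq => [->|_] /=; last by rewrite scaler0 add0r.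
  by rewrite ltnn addr0 -[LHS]mulr1.
have GM : bd (polar K) (dnorm f) G.
  move=> u n uK; rewrite pairC -gfin -[leRHS]mulr1; apply: gabs; exact: bdK_res.
have [phi [phid _ zV]] := dual_decomposition x_le1 x_dense GM.
pose h i := G i - phi (x i).
have phiM : bd (polar K) (dnorm phi) (fun i => phi (x i)).
  apply: dual_bd; [exact: dual_lin|by move=> y; exact: dual_bound|exact: dnorm_ge0].
have [z zE] := @seqT_exists R (predual_space x_le1) _ h zV (bdB GM phiM).
exists z; apply/funext => w; rewrite /kernel_action zE.
have wN := norm_bdW w.
(* Truncations of [w] converge to it in K-norm by bounded completeness, so the extension is
   recovered from its values on unit vectors. *)
have -> : f w = act G w.
  rewrite -[w in LHS]toWK -gY; last first.
    by split; [exact: (seq_val_member w)|exists `|w|].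
  apply/esym/act_eq/cvgrPdist_le => e e0.
  have d0 : 0 < e / (dnorm f + 1) by rewrite divr_gt0// ltr_wpDl.
  have [n hn] := boundedly_complete wN d0; exists n => // m /= nm.
  rewrite -gfin -gB; [|by exists (`|w|)|exact: Dres wN].
  rewrite (_ : _ - _ = tail m w); last first.
    apply/funext => i; rewrite /res /tail !fctE /=.
    by case: ltnP => _; rewrite ?subrr ?subr0.
  have hm : bd K (e / (dnorm f + 1)) (tail m w).
    by rewrite -(maxn_idPl nm) -tail_tail; exact: bdK_tail.
  rewrite (le_trans (gabs _ _ hm))// mulrCA ler_piMr ?(ltW e0)//.
  by rewrite ler_pdivrMr ?ltr_wpDl// mul1r lerDl.
have : act (fun i => phi (x i)) w = 0.
  by rewrite (act_dual phid (seq_val_member w)) (lin0 (dual_lin phid)).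
have := act_lin_l x_le1 (-1) phiM GM wN.
rewrite (_ : (fun i => -1 * _ + _) = h); last by apply/funext => i; rewrite /h mulN1r addrC.
by move=> -> ->; rewrite mulr0 add0r.
Qed.

Lemma kernel_action_norm_le z : dnorm (kernel_action z : seqspace_banach kernel_space -> R) <= `|z|.
Proof.
apply: (@dnorm_le R (seqspace_banach kernel_space)) => // w.
exact: (act_bound x_le1 (norm_bdZ z) (norm_bdW w)).
Qed.

(* A vector [b] of the unit ball is corrected into the kernel by subtracting a
   lift of its image supported so far out that [z] barely sees it. *)
Lemma kernel_action_norm_ge (z : Z) :
  `|z| <= 3 * dnorm (kernel_action z : seqspace_banach kernel_space -> R).
Proof.
set d := dnorm _; apply: norm_le_bd => u n uK; apply/ler_addgt0Pr => e e0.
pose b := res 0 n u; have bK : polar K b := polarK_res 0 n uK.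
have [m hm] := vanishing_norm z (divr_gt0 e0 (ltr0n _ 2)).
pose y := vsum x b 0 n.
have y1 : `|y| <= 1 by exact: vsum_bd.
have by_ : vsum x b 0 k @[k --> \oo] --> y.
  apply/cvgrPdist_lt => d' d0; exists n => // k /= nk.
  by rewrite /y /b !vsum_res maxnn minnn (minn_idPl nk) subrr normr0.
have [c [cb c0 cy]] := greedy_lift x_le1 x_dense m y.
have c2 : bd K 2 c by apply: bd_le cb; lra.
have [w wE] := @seqT_exists R kernel_space _ _ (in_kernel_sub by_ cy) (bdB bK c2).
(* 1 for the vector [b] and 2 for the greedy lift of its image, which has norm at most 1; this is
   the constant of the lemma. *)
have w3 : `|w| <= 3 by apply: norm_le_bd; rewrite wE; apply: bd_le (bdB bK c2); lra.
have zw : kernel_action z w = act z b - act z c.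
  have := act_lin_r x_le1 (-1) (norm_bdZ z) c2 bK; rewrite mulN1r addrC => <-.
  by rewrite /kernel_action wE; congr act; apply/funext => i; rewrite mulN1r addrC.
have zb : act z b = pair_ u z 0 n.
  rewrite (@act_finite _ _ _ n) => [|i ni]; first by rewrite pair_res_sub// pairC.
  by rewrite /b /res ltnNge ni andbF.
have zc : `|act z c| <= e.
  have -> : act z c = act (tail m z) c.
    have E k : pair_ (tail m z) c 0 k = pair_ z c 0 k.
      apply: eq_bigr => i _.
      by rewrite /tail; case: leqP => // im; rewrite c0// !mulr0.
    by rewrite /act; under [in RHS]eq_fun do rewrite E.
  by apply: le_trans (act_bound x_le1 hm c2) _; rewrite mulfVK.
have := dual_bound w (kernel_action_dual z); rewrite -/d zw zb => h.
have d0 : 0 <= d := dnorm_ge0 (kernel_action_dual z).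
have dw : d * `|w| <= d * 3 by rewrite ler_wpM2l.
rewrite -[pair_ u z 0 n](subrK (act z c)) (le_trans (ler_normD _ _))//.
by move: h dw zc; lra.
Qed.

Lemma predual_isomorphic_to_dual : isomorphic_to_dual (seqspace_banach (predual_space x_le1)).
Proof.
exists (seqspace_banach kernel_space), kernel_action; split; first exact: kernel_action_dual.
split.
  move=> c z z'; apply/funext => w.
  exact: (act_lin_l x_le1 c (norm_bdZ z) (norm_bdZ z') (norm_bdW w)).
split; first exact: kernel_action_onto.
exists 3^-1, 1; split; first by rewrite invr_gt0.
move=> z; rewrite mul1r; split; last exact: kernel_action_norm_le.
by rewrite ler_pdivrMl//; exact: kernel_action_norm_ge.
Qed.

End KernelSpace.

(** * The bidual of Z as the dual of W1, and its decomposition *)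

Section Bidual.
Variables (R : realType) (X : completeNormedModType R) (x : nat -> X).
Hypothesis x_le1 : forall i, `|x i| <= 1.
Hypothesis x_dense : forall y n (e : R), 0 < e ->
  exists2 i, (n <= i)%N & `| `|y| *: x i - y| < e.
Notation K := (K x).
Notation Z := (seqspace_banach (predual_space x_le1)).
Notation seqZ := (seqT (predual_space x_le1)).
Notation basis := (basis x_le1).

Definition coefs (f : Z -> R) : nat -> R := fun i => f (basis i).

Lemma K_dual_bd g : K g -> bd (polar K) 1 g.
Proof. by move=> Kg u n uK; rewrite pairC; exact: uK. Qed.

(** A truncated element of [K] is the coordinate sequence of a vector of norm at most 1 in Z, on
    which [f] is evaluated. This makes Z^* a space of sequences of finite K-norm. *)
Lemma coefs_bd f : dual_el f -> bd K (dnorm f) (coefs f).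
Proof.
move=> fd g n Kg.
have -> : pair_ g (coefs f) 0 n = f (\sum_(i < n) g i *: basis i).
  rewrite (lin_sum _ _ (dual_lin fd)) /pair_ big_mkord; apply: eq_bigr => i _.
  by rewrite (linZ _ _ (dual_lin fd)).
apply: le_trans (dual_bound _ fd) _; rewrite ler_piMr ?dnorm_ge0//.
by apply: norm_le_bd; rewrite basis_sum; apply: K_dual_bd; exact: K_res.
Qed.

Lemma dual_act f (z : seqZ) : dual_el f -> f z = act z (coefs f).
Proof.
move=> fd; apply/esym/act_eq/cvgrPdist_le => e e0.
have d0 := dnorm_ge0 fd; have d1 : 0 < dnorm f + 1 by rewrite ltr_wpDl.
have [n hn] := vanishing_norm z (divr_gt0 e0 d1); exists n => // m /= nm.
have -> : pair_ z (coefs f) 0 m = f (\sum_(i < m) z i *: basis i).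
  rewrite (lin_sum _ _ (dual_lin fd)) /pair_ big_mkord; apply: eq_bigr => i _.
  by rewrite (linZ _ _ (dual_lin fd)).
rewrite -(linB _ _ (dual_lin fd)); apply: le_trans (dual_bound _ fd) _.
apply: (@le_trans _ _ (dnorm f * (e / (dnorm f + 1)))).
  rewrite ler_wpM2l//; apply: norm_le_bd; rewrite trunc_tail.
  exact: (bd_tail_mono nm hn).
by rewrite mulrCA ler_piMr ?(ltW e0)// ler_pdivrMr// mul1r lerDl.
Qed.

Lemma act_split M G N a n : bd (polar K) M G -> bd K N a ->
  act G a = act G (tail n a) + pair_ G a 0 n.
Proof.
move=> GM aN.
have -> : pair_ G a 0 n = act G (res 0 n a).
  rewrite (@act_finite _ _ _ n) ?pair_res_sub// => i ni.
  by rewrite /res ltnNge ni andbF.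
rewrite -[act G (tail n a)]mul1r -(act_lin_r x_le1 1 GM (bdK_tail n aN) (bdK_res 0 n aN)).
congr act; apply/funext => i; rewrite mul1r /tail /res /=.
by case: ltnP => _; rewrite ?add0r ?addr0.
Qed.

Lemma coord_bounded i (z : Z) : `|seq_val z i| <= 1 * `|z|.
Proof. by rewrite mul1r; exact: coord_le_norm. Qed.

Lemma coord_dual i : dual_el (fun z : Z => seq_val z i).
Proof. by apply: bounded_dual (coord_bounded i). Qed.

Lemma coord_dnorm i : dnorm (fun z : Z => seq_val z i) <= 1.
Proof. by apply: dnorm_le => // z; exact: coord_bounded. Qed.

Lemma coefs_coord i : coefs (fun z : Z => seq_val z i) = unit_seq R i.
Proof. by apply/funext => k; rewrite /coefs basisE /unit_seq eq_sym. Qed.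

Lemma fin_step u n : (fun z : Z => pair_ u (seq_val z) 0 n.+1) =
  fun z : Z => u n * seq_val z n + pair_ u (seq_val z) 0 n.
Proof.
by apply/funext => z; rewrite (@pair_cat _ _ _ 0 n n.+1)// [X in _ + X]/pair_ big_nat1 addrC.
Qed.

Lemma fin_dual u n : dual_el (fun z : Z => pair_ u (seq_val z) 0 n).
Proof.
elim: n => [|n IH].
  rewrite (_ : (fun _ => _) = fun=> 0); first exact: dual_zero.
  by apply/funext => z; rewrite pair_geq.
by rewrite fin_step; exact: dual_comb (coord_dual n) IH.
Qed.

Lemma fin_dnorm u n : polar K u -> dnorm (fun z : Z => pair_ u (seq_val z) 0 n) <= 1.
Proof.
move=> uK; apply: dnorm_le => // z; rewrite mul1r.
by apply: (bd_norm (z : seqZ)).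
Qed.

(** [bidual_el] gives linearity on dual elements only, so coordinates are split off one at a time,
    each remainder being a dual element. *)
Lemma bidual_fin F u n : bidual_el F ->
  F (fun z : Z => pair_ u (seq_val z) 0 n) = pair_ (fun i => F (fun z => seq_val z i)) u 0 n.
Proof.
move=> [Fl [M FM]]; elim: n => [|n IH].
  rewrite (_ : (fun _ => _) = fun=> 0); last by apply/funext => z; rewrite pair_geq.
  rewrite pair_geq//; apply/eqP; rewrite -normr_le0; apply: le_trans (FM _ (@dual_zero _ _)) _.
  have : dnorm (fun _ : Z => 0 : R) <= 0.
    by apply: dnorm_le => // z; rewrite normr0 mul0r.
  have := dnorm_ge0 (@dual_zero R Z) => h1 h2.
  by rewrite (_ : dnorm _ = 0) ?mulr0//; apply/eqP; rewrite eq_le h1 h2.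
rewrite fin_step Fl; [|exact: coord_dual|exact: fin_dual].
by rewrite IH (@pair_cat _ _ u 0 n n.+1)// [X in _ = _ + X]/pair_ big_nat1 addrC mulrC.
Qed.

(** This is Z^** = W1^*. By bounded completeness the coefficients of [f] have small tails, so [f] is
    a dual-norm limit of combinations of coordinate functionals, and [F] is determined by its values
    on these. *)
Lemma bidual_act F : bidual_el F -> exists2 M,
  bd (polar K) M (fun i => F (fun z : Z => seq_val z i)) &
  forall f, dual_el f -> F f = act (fun i => F (fun z : Z => seq_val z i)) (coefs f).
Proof.
move=> Fb; have [Fl [M FM]] := Fb; pose G i := F (fun z : Z => seq_val z i).
have FM' f : dual_el f -> `|F f| <= `|M| * dnorm f.
  by move=> fd; rewrite (le_trans (FM _ fd))// ler_wpM2r ?dnorm_ge0// ler_norm.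
have GM : bd (polar K) `|M| G.
  move=> u n uK; rewrite pairC -bidual_fin// (le_trans (FM' _ (fin_dual u n)))//.
  by rewrite ler_piMr// fin_dnorm.
exists `|M| => // f fd; apply/esym/act_eq/cvgrPdist_le => e e0.
have fK := coefs_bd fd; have M1 : 0 < `|M| + 1 by rewrite ltr_wpDl.
have [n hn] := boundedly_complete fK (divr_gt0 e0 M1); exists n => // m /= nm.
have hm : bd K (e / (`|M| + 1)) (tail m (coefs f)).
  by rewrite -(maxn_idPl nm) -tail_tail; exact: bdK_tail.
rewrite -bidual_fin//.
have fdm := fin_dual (coefs f) m.
have -> : F f - F (fun z => pair_ (coefs f) (seq_val z) 0 m) =
    F (fun z => -1 * pair_ (coefs f) (seq_val z) 0 m + f z).
  by rewrite Fl// mulN1r addrC.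
apply: le_trans (FM' _ (dual_comb (-1) fdm fd)) _.
apply: (@le_trans _ _ (`|M| * (e / (`|M| + 1)))).
  rewrite ler_wpM2l//; apply: dnorm_le => [|z]; first by rewrite divr_ge0// ltW.
  rewrite (dual_act z fd) (act_split m (bd_norm (z : seqZ)) fK).
  rewrite mulN1r pairC addrC addrK mulrC.
  exact: (act_bound x_le1 (bd_norm (z : seqZ)) hm).
by rewrite mulrCA ler_piMr ?(ltW e0)// ler_pdivrMr// mul1r lerDl.
Qed.

(** The pullback of [phi] by Q, seen as an element of Z^**; it is the embedding of X^* required by
    the decomposition. *)
Definition lift_dual (phi : X -> R) (f : Z -> R) : R := act (fun i => phi (x i)) (coefs f).

Lemma lift_bd phi : dual_el phi -> bd (polar K) (dnorm phi) (fun i => phi (x i)).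
Proof.
move=> phid; apply: dual_bd; [exact: dual_lin|by move=> y; exact: dual_bound|exact: dnorm_ge0].
Qed.

Lemma lift_dual_bound phi f : dual_el phi -> dual_el f ->
  `|lift_dual phi f| <= dnorm phi * dnorm f.
Proof. by move=> phid fd; exact: (act_bound x_le1 (lift_bd phid) (coefs_bd fd)). Qed.

Lemma lift_dual_bidual phi : dual_el phi -> bidual_el (lift_dual phi).
Proof.
move=> phid; split; last by exists (dnorm phi) => f; exact: lift_dual_bound.
by move=> a f g fd gd; exact: (act_lin_r x_le1 a (lift_bd phid) (coefs_bd fd) (coefs_bd gd)).
Qed.

Lemma lift_dual_coord phi i : lift_dual phi (fun z : Z => seq_val z i) = phi (x i).
Proof.
rewrite /lift_dual coefs_coord (@act_finite _ _ _ i.+1) => [|k ik].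
  by rewrite pairC pair_unit.
by rewrite /unit_seq gtn_eqF.
Qed.

Section LowerBound.
Variables (z : seqZ) (phi : X -> R).
Hypothesis phid : dual_el phi.
Let F (f : Z -> R) := f z + lift_dual phi f.
Let B := ddnorm F.

Let F_le f : dual_el f -> dnorm f <= 1 -> `|F f| <= `|z : Z| + dnorm phi.
Proof.
move=> fd f1; rewrite (le_trans (ler_normD _ _))// lerD//.
  by rewrite (le_trans (dual_bound _ fd))// ler_piMl.
by rewrite (le_trans (lift_dual_bound phid fd))// ler_piMr// dnorm_ge0.
Qed.

Lemma bidual_sum_le : B <= `|z : Z| + dnorm phi.
Proof.
apply: ge_sup => [|_ [f [fd f1] <-]]; last exact: F_le.
exists `|F (fun z : Z => seq_val z 0)|; exists (fun z : Z => seq_val z 0) => //.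
by split; [exact: coord_dual|exact: coord_dnorm].
Qed.

Let F_B f : dual_el f -> dnorm f <= 1 -> `|F f| <= B.
Proof.
move=> fd f1; apply: ub_le_sup; last by exists f.
by exists (`|z : Z| + dnorm phi) => _ [g [gd g1] <-]; exact: F_le.
Qed.

Let B0 : 0 <= B.
Proof. by apply: le_trans (F_B (coord_dual 0) (coord_dnorm 0)). Qed.

(* The coordinates of [z] tend to 0, so only [phi] is seen by the coordinates of large index. *)
Let phi_B y : `|phi y| <= B * `|y|.
Proof.
have phil := dual_lin phid; have p0 := dnorm_ge0 phid.
apply/ler_addgt0Pr => e e0.
pose C := dnorm phi + `|y| + 1.
have C0 : 0 < C by rewrite ltr_wpDl// addr_ge0.
have d0 : 0 < e / C by rewrite divr_gt0.
have [n hn] := vanishing_norm z d0.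
have [i ni iy] := x_dense y n d0.
have zi : `|z i| <= e / C.
  by have := bd_coord (polar_unit x_le1) i hn; rewrite /tail ni.
have := F_B (coord_dual i) (coord_dnorm i); rewrite /F lift_dual_coord => FB.
have phixi : `|phi (x i)| <= B + e / C.
  have := ler_normB (z i + phi (x i)) (z i); rewrite addrAC subrr add0r.
  by move: FB zi; lra.
have h1 : `|phi (`|y| *: x i - y)| <= dnorm phi * (e / C).
  by rewrite (le_trans (dual_bound _ phid))// ler_wpM2l// ltW.
rewrite (linB _ _ phil) (linZ _ _ phil) in h1.
have h2 : `| `|y| * phi (x i)| <= `|y| * (B + e / C).
  by rewrite normrM normr_id ler_wpM2l.
have eC : e = (dnorm phi + `|y| + 1) * (e / C) by rewrite mulrC mulfVK// gt_eqF.
have := ler_normB (`|y| * phi (x i)) (`|y| * phi (x i) - phi y); rewrite subKr.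
move: h1 h2; rewrite [in X in _ -> _ -> _ -> X]eC mulrDr; move: (e / C) d0 => d d0.
rewrite (mulrC B) !mulrDl mul1r; lra.
Qed.

(** [phi_B] gives |phi| <= B; by subtraction |z| <= B + |phi| <= 2 B, whence the factor 1/3. *)
Lemma bidual_sum_ge : 3^-1 * (`|z : Z| + dnorm phi) <= B.
Proof.
have pB : dnorm phi <= B by apply: dnorm_le B0 phi_B.
have zB : `|z : Z| <= B + B.
  apply: norm_le_bd => u n uK.
  have f1 := fin_dnorm n uK; have fd := fin_dual u n.
  have := F_B fd f1; rewrite /F => FB.
  have := lift_dual_bound phid fd => lB.
  have {}lB := le_trans lB (_ : _ <= dnorm phi).
  have {}lB : `|lift_dual phi (fun z0 : Z => pair_ u (seq_val z0) 0 n)| <= dnorm phi.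
    by apply: lB; rewrite ler_piMr// dnorm_ge0.
  rewrite -[pair_ u z 0 n](addrK (lift_dual phi (fun z0 : Z => pair_ u (seq_val z0) 0 n))).
  by rewrite (le_trans (ler_normB _ _))// lerD// (le_trans lB).
by rewrite ler_pdivrMl//; move: pB zB; lra.
Qed.

End LowerBound.

(** The coefficient sequence of [F] is split by [dual_decomposition]: its vanishing-tail part is an
    element of Z, and the rest is the lift of [phi]. *)
Lemma predual_bidual_decomp : bidual_decomp Z X.
Proof.
exists lift_dual; split; first exact: lift_dual_bidual.
split.
  by move=> a phi psi phid psid f fd;
     exact: (act_lin_l x_le1 a (lift_bd phid) (lift_bd psid) (coefs_bd fd)).
split.
  move=> F Fb; have [M GM Fact] := bidual_act Fb.
  have [phi [phid _ zV]] := dual_decomposition x_le1 x_dense GM.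
  have [z zE] := @seqT_exists R (predual_space x_le1) _ _ zV (bdB GM (lift_bd phid)).
  exists z, phi => // f fd; rewrite (Fact _ fd) /canJ (dual_act z fd) zE.
  have := act_lin_l x_le1 (-1) (lift_bd phid) GM (coefs_bd fd).
  set A := act _ _ => AE; rewrite (_ : act (fun i => _ - _) _ = A).
    by rewrite AE /lift_dual; ring.
  by congr act; apply/funext => i; rewrite mulN1r addrC.
exists 3^-1, 1; split; first by rewrite invr_gt0.
move=> z phi phid; rewrite mul1r; split.
  exact: (bidual_sum_ge z phid).
exact: (bidual_sum_le z phid).
Qed.

End Bidual.

Theorem theorem4 (R : realType) (X : completeNormedModType R) :
  dual_separable X ->
  exists Z : completeNormedModType R,
    separable Z /\ isomorphic_to_dual Z /\ asymptotic_c0 Z /\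
    bidual_decomp Z X.
Proof.
move=> /dual_separable_separable /separable_ball_seq [x [x_le1 x_dense]].
exists (seqspace_banach (predual_space x_le1)).
split; first exact: predual_separable.
split; first exact: predual_isomorphic_to_dual x_dense.
split; first exact: predual_asymptotic_c0.
exact: predual_bidual_decomp x_dense.
Qed.
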